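(* Let $X$ be an infinite dimensional Banach space. Then $B(X)$ is not subprojective.
   Context: $B(X)$ is the Banach space of bounded linear operators on $X$ with the operator norm. A Banach space $E$ is subprojective if every closed infinite dimensional subspace $Y \subset E$ contains a closed infinite dimensional subspace $Z \subset Y$ that is complemented in $E$. *)

(* Defs.v *)
From HB Require Import structures.
From mathcomp Require Import all_boot all_order all_algebra.
From mathcomp Require Import all_classical all_reals all_analysis.
From mathcomp Require Import complex.

Set Implicit Arguments.
Unset Strict Implicit.
Unset Printing Implicit Defensive.

Import Order.TTheory GRing.Theory Num.Theory.
Import numFieldNormedType.Exports.

Local Open Scope classical_set_scope.
Local Open Scope ring_scope.

(* Banach spaces are real or complex: the field of scalars is R or R[i].      *)
Variant scalar_kind := RealScalars | ComplexScalars.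

Definition scalars (R : realType) (s : scalar_kind) : numFieldType :=
  match s with RealScalars => R | ComplexScalars => R[i] end.

(* A norm takes its values in the field of scalars, so a supremum of norms    *)
(* is computed in R through the following two maps.                           *)
Definition to_real (R : realType) (s : scalar_kind) : scalars R s -> R :=
  match s with RealScalars => id | ComplexScalars => @complex.Re R end.

Definition of_real (R : realType) (s : scalar_kind) : R -> scalars R s :=
  match s with RealScalars => id | ComplexScalars => real_complex R end.

Section scalars_theory.
Context {R : realType} {s : scalar_kind}.
Implicit Types (a b : R) (x y : scalars R s).

Lemma of_realK : cancel (@of_real R s) (@to_real R s).
Proof. by case: s. Qed.

Lemma to_realK x : 0 <= x -> of_real s (to_real x) = x.
Proof.
case: s x => //= -[u v]; rewrite lecE /= => /andP[/eqP -> _].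
by [].
Qed.

Lemma ler_of_real a b : (of_real s a <= of_real s b) = (a <= b).
Proof. by case: s => //=; rewrite lecR. Qed.

Lemma ler_to_real x y : x <= y -> to_real x <= to_real y.
Proof. by case: s x y => //= -[u v] [u' v']; rewrite lecE /= => /andP[]. Qed.

End scalars_theory.

Section bounded_operator.
Context {K : numFieldType} (X Y : normedModType K).

Definition bounded_linear_pred : {pred X -> Y} :=
  [pred f : X -> Y | `[< linear f /\ exists M, forall x, `|f x| <= M * `|x| >]].

Record bounded_operator : Type := BoundedOperator {
  bounded_operator_fun :> X -> Y ;
  bounded_operator_subproof : bounded_operator_fun \in bounded_linear_pred }.

HB.instance Definition _ := [isSub of bounded_operator for bounded_operator_fun].
HB.instance Definition _ := [Choice of bounded_operator by <:].

Lemma bounded_linear_submod_closed : submod_closed bounded_linear_pred.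
Proof.
split=> [|a f g /asboolP[lf [M Mf]] /asboolP[lg [N Ng]]]; apply/asboolP.
  split=> [b x y|]; first by rewrite /= scaler0 addr0.
  by exists 0 => x; rewrite /= normr0 mul0r.
split=> [b x y|].
  rewrite !fctE lf lg !scalerDr !scalerA [a * b]mulrC -!addrA.
  by congr (_ + _); rewrite addrCA.
exists (`|a| * M + N) => x; rewrite !fctE.
rewrite (le_trans (ler_normD _ _))// normrZ mulrDl lerD// -mulrA.
by rewrite ler_wpM2l.
Qed.

HB.instance Definition _ := GRing.SubChoice_isSubLmodule.Build
  K (X -> Y) bounded_linear_pred bounded_operator bounded_linear_submod_closed.

Lemma bounded_operator_linear (f : bounded_operator) : linear f.
Proof. by case: f => f /= /asboolP[]. Qed.

HB.instance Definition _ (f : bounded_operator) :=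
  GRing.isLinear.Build K X Y *:%R f (bounded_operator_linear f).

Lemma bounded_operatorP (f : bounded_operator) :
  exists M, forall x, `|f x| <= M * `|x|.
Proof. by case: f => f /= /asboolP[]. Qed.

Lemma bounded_operatorD (f g : bounded_operator) x : (f + g) x = f x + g x.
Proof. by []. Qed.

Lemma bounded_operatorB (f g : bounded_operator) x : (f - g) x = f x - g x.
Proof. by []. Qed.

Lemma bounded_operatorZ a (f : bounded_operator) x : (a *: f) x = a *: f x.
Proof. by []. Qed.

End bounded_operator.

Section operator_norm.
Context {R : realType} {s : scalar_kind} {X Y : normedModType (scalars R s)}.
Implicit Types f g : bounded_operator X Y.

Definition operator_norm f : scalars R s :=
  of_real s (sup [set to_real `|f x| | x in [set x : X | `|x| <= 1]]).

Let has_sup_norms f :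
  has_sup [set to_real `|f x| | x in [set x : X | `|x| <= 1]].
Proof.
split; first by exists (to_real `|f 0|), 0 => //=; rewrite normr0.
have [M fM] := bounded_operatorP f; exists (to_real `|M|) => _ [x /= x1 <-].
apply: ler_to_real; rewrite (le_trans (fM x))//.
have := normr_ge0 (f x) => /le_trans/(_ (fM x)) Mx0.
by rewrite -(ger0_norm Mx0) normrM normr_id ler_piMr.
Qed.

Lemma operator_norm_unit f x : `|x| <= 1 -> `|f x| <= operator_norm f.
Proof.
move=> x1; rewrite -(to_realK (normr_ge0 (f x))) ler_of_real.
by apply: sup_ubound; [exact: (has_sup_norms f).2|exists x].
Qed.

Lemma operator_norm_ge0 f : 0 <= operator_norm f.
Proof.
by rewrite (le_trans (normr_ge0 (f 0)))// operator_norm_unit// normr0.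
Qed.

Lemma operator_norm_bound f x : `|f x| <= operator_norm f * `|x|.
Proof.
have [->|x0] := eqVneq x 0; first by rewrite linear0 !normr0 mulr0.
have nx : 0 < `|x| by rewrite normr_gt0.
rewrite -ler_pdivrMr// mulrC.
have -> : `|x|^-1 * `|f x| = `|f (`|x|^-1 *: x)|.
  by rewrite linearZ normrZ normfV normr_id.
by apply: operator_norm_unit; rewrite normrZ normfV normr_id mulVf// gt_eqF.
Qed.

Lemma operator_norm_le f M :
  (forall x, `|x| <= 1 -> `|f x| <= M) -> operator_norm f <= M.
Proof.
move=> fM; have M0 : 0 <= M.
  by rewrite (le_trans (normr_ge0 (f 0)))// fM// normr0.
rewrite -(to_realK M0) ler_of_real; apply: ge_sup.
  exact: (has_sup_norms f).1.
by move=> _ [x /= x1 <-]; apply: ler_to_real; exact: fM.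
Qed.

Let operator_normD f g :
  operator_norm (f + g) <= operator_norm f + operator_norm g.
Proof.
apply: operator_norm_le => x x1; rewrite bounded_operatorD.
by rewrite (le_trans (ler_normD _ _))// lerD// operator_norm_unit.
Qed.

Let operator_normZ_le a f : operator_norm (a *: f) <= `|a| * operator_norm f.
Proof.
apply: operator_norm_le => x x1; rewrite bounded_operatorZ normrZ.
by rewrite ler_wpM2l// operator_norm_unit.
Qed.

Let operator_normZ a f : operator_norm (a *: f) = `|a| * operator_norm f.
Proof.
apply/eqP; rewrite eq_le operator_normZ_le /=.
have [->|a0] := eqVneq a 0; first by rewrite normr0 mul0r operator_norm_ge0.
rewrite -ler_pdivlMl ?normr_gt0// -normfV.
by rewrite -{1}(scalerK a0 f) operator_normZ_le.
Qed.

Let operator_norm0_eq0 f : operator_norm f = 0 -> f = 0.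
Proof.
move=> f0; apply/val_inj/funext => x; apply/eqP.
rewrite -normr_le0 (le_trans (operator_norm_bound f x))//.
by rewrite f0 mul0r.
Qed.

HB.instance Definition _ := Lmodule_isNormed.Build (scalars R s)
  (bounded_operator X Y) operator_normD operator_normZ operator_norm0_eq0.

Lemma operator_normE f : `|f| = operator_norm f.
Proof. by []. Qed.

End operator_norm.

Section bounded_operator_complete.
Context {R : realType} {s : scalar_kind}.
Context {X : normedModType (scalars R s)} {Y : completeNormedModType (scalars R s)}.

Let bounded_operator_cauchy_cvg (F : set_system (bounded_operator X Y)) :
  ProperFilter F -> cauchy F -> cvg F.
Proof.
move=> FF /cauchy_ballP Fc.
have dist e : 0 < e -> exists2 A, F A &
    forall f g, A f -> A g -> forall x, `|f x - g x| <= e * `|x|.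
  move=> e0; have [[A B] /= [FA FB] AB] := Fc _ e0.
  exists (A `&` B); first exact: filterI.
  move=> f g [Af _] [_ Bg] x; rewrite -bounded_operatorB.
  rewrite (le_trans (operator_norm_bound _ _))// ler_wpM2r// ltW//.
  by have := AB (f, g) (conj Af Bg); rewrite /= -ball_normE.
have Fx x : cvg ((fun f : bounded_operator X Y => f x) @ F).
  apply: cauchy_cvg; apply/cauchy_ballP => e e0.
  have e1 : 0 < e / (`|x| + 1) by rewrite divr_gt0// ltr_wpDl.
  have [A FA Ad] := dist _ e1; near_simpl.
  exists (A, A) => //= -[f g] /= [Af Ag]; rewrite -ball_normE /=.
  rewrite (le_lt_trans (Ad _ _ Af Ag x))// mulrAC ltr_pdivrMr ?ltr_wpDl//.
  by rewrite ltr_pM2l// ltrDl.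
pose L x := lim ((fun f : bounded_operator X Y => f x) @ F).
have FL x : (fun f : bounded_operator X Y => f x) @ F --> L x by exact: Fx.
have Llin : linear L.
  move=> a x y; apply/esym/(cvg_unique _ _ (FL (a *: x + y))) => //.
  have -> : (fun f : bounded_operator X Y => f (a *: x + y)) =
            (fun f => a *: f x + f y).
    by apply/funext => f; rewrite linearP.
  by apply: cvgD; [exact: cvgZl_tmp|]; exact: FL.
have distL e (A : set (bounded_operator X Y)) :
    (forall f g, A f -> A g -> forall x, `|f x - g x| <= e * `|x|)
    -> F A -> forall f, A f -> forall x, `|f x - L x| <= e * `|x|.
  move=> Ad FA f Af x; apply/ler_addgt0Pr => d d0.
  have /cvgrPdist_lt/(_ _ d0) FLd := FL x.
  have [g [Ag gd]] := filter_ex (filterI FA FLd).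
  rewrite -(subrKA (g x)) (le_trans (ler_normD _ _))// lerD ?Ad//.
  by rewrite distrC ltW.
have Lb : L \in @bounded_linear_pred _ X Y.
  apply/asboolP; split => //.
  have [A FA Ad] := dist _ ltr01; have [f Af] := filter_ex FA.
  exists (operator_norm f + 1) => x.
  rewrite -[L x](subrK (f x)) addrC mulrDl (le_trans (ler_normD _ _))//.
  by rewrite lerD ?operator_norm_bound// distrC (distL _ A).
apply/cvg_ex; exists (BoundedOperator Lb).
apply/cvgrPdist_le => e e0; have [A FA Ad] := dist _ e0.
apply: filterS (FA) => f Af; rewrite operator_normE; apply: operator_norm_le.
move=> x x1; rewrite bounded_operatorB /= distrC.
by rewrite (le_trans (distL _ _ Ad FA _ Af x))// ler_piMr// ltW.
Qed.

HB.instance Definition _ := Uniform_isComplete.Build (bounded_operator X Y)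
  bounded_operator_cauchy_cvg.

End bounded_operator_complete.

Section subprojective.
Context {K : numFieldType}.

Definition linear_subspace (E : lmodType K) (Y : set E) : Prop :=
  Y 0 /\ forall a x y, Y x -> Y y -> Y (a *: x + y).

(* For a linear subspace Y: Y is the span of a finite family.                 *)
Definition finite_dimensional (E : lmodType K) (Y : set E) : Prop :=
  exists n (v : 'I_n -> E), Y = range (fun c : 'I_n -> K => \sum_i c i *: v i).

Definition infinite_dimensional (E : lmodType K) (Y : set E) : Prop :=
  ~ finite_dimensional Y.

(* Z is the range of a bounded linear projection on E.                        *)
Definition complemented (E : normedModType K) (Z : set E) : Prop :=
  exists P : {linear E -> E},
    [/\ continuous P, forall x, P (P x) = P x & range P = Z].

Definition subprojective (E : completeNormedModType K) : Prop :=
  forall Y : set E,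
    closed Y -> linear_subspace Y -> infinite_dimensional Y ->
    exists2 Z : set E, Z `<=` Y &
      [/\ closed Z, linear_subspace Z, infinite_dimensional Z & complemented Z].

End subprojective.

(* Main.v *)
From HB Require Import structures.
Require Import Defs.
From mathcomp Require Import all_boot all_order all_algebra.
From mathcomp Require Import all_classical all_reals all_analysis.
From mathcomp Require Import complex ring lra.

(** Let X be infinite dimensional and suppose that B(X) is subprojective.

    A functional f with f e = 1 embeds X in B(X) as x |-> f(.) x, and
    evaluation at e retracts this embedding, so X is subprojective too
    (subprojective_operators).

    A subprojective space contains an unconditional basic sequence
    (subprojective_unconditional_sequence). By Gowers' dichotomy this holds as
    soon as no subspace of X is hereditarily indecomposable, and indeed every
    closed infinite dimensional subspace of X contains two infinite dimensional
    subspaces at a positive angle, in the range and in the kernel of a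
    projection. The passage from pairs of subspaces to a sequence follows
    Maurey's proof of the dichotomy. Fix
    a countable dense subring D of the scalars, a biorthogonal sequence, and the
    countable D-module V that it spans. A pair (E, F) of subsets of V is
    intertwined in a large submodule Z when, for all large U, U' in Z, the sets
    E + U and F + U' contain x and y with |x - y| < e |x + y|. As V is
    countable, a diagonal argument (fusion) decides for all x at once
    whether (E + D x, F) is intertwined; so a pair which is nowhere intertwined
    remains so after adjoining to either side any vector of a suitable large
    submodule (separated_adjoin). Iterating, all disjoint parts of the resulting
    sequence span subspaces at a positive angle, which is unconditionality
    (separated_blocks, subset_bound_all).

    Multipliers are then bounded on the closed span W of the sequence. A
    subspace of W complemented in X by P, and blocks carried by vectors of this
    subspace, give operators S a: apply P, then multiply the k-th block by a k.
    The norm of S a is equivalent to sup |a k|, so B(X) contains l_infinity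
    (linf_operators).

    A space E containing l_infinity is not subprojective
    (linf_not_subprojective). Otherwise some infinite dimensional subspace of
    the copy of c_0 is complemented in E. It contains a gliding hump z k, and the
    map sending a to the sum of the a k z k, followed by the projection minus
    the identity, kills the finitely supported a. In an uncountable almost disjoint family of subsets of
    nat, all but countably many have an indicator killed by every coordinate of
    this map (annihilated_branch). The corresponding sum of humps is then fixed
    by the projection, hence is in c_0, which is absurd. *)

Set Implicit Arguments.
Unset Strict Implicit.
Unset Printing Implicit Defensive.

Import Order.TTheory GRing.Theory Num.Theory.
Import numFieldNormedType.Exports.

Local Open Scope classical_set_scope.
Local Open Scope ring_scope.

(** * Real-valued norms *)

Section real_norm.
Context {R : realType} {s : scalar_kind}.
Local Notation K := (scalars R s).

(** Moduli and norms are read in R, where the order is total and linear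
    arithmetic is available; K itself is only partially ordered. *)
Definition ab (a : K) : R := to_real `|a|.
Definition nr (X : normedModType K) (x : X) : R := to_real `|x|.

Lemma to_realD (a b : K) : to_real (a + b) = to_real a + to_real b.
Proof. by case: s a b => //= -[a a'] [b b']. Qed.

Lemma of_realD (a b : R) : of_real s (a + b) = of_real s a + of_real s b.
Proof. by case: s => //=; rewrite rmorphD. Qed.

Lemma of_realN (a : R) : of_real s (- a) = - of_real s a.
Proof. by case: s => //=; rewrite rmorphN. Qed.

Lemma of_realB (a b : R) : of_real s (a - b) = of_real s a - of_real s b.
Proof. by rewrite of_realD of_realN. Qed.

Lemma of_realM (a b : R) : of_real s (a * b) = of_real s a * of_real s b.
Proof. by case: s => //=; rewrite rmorphM. Qed.

Lemma of_real0 : of_real s (0 : R) = 0.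
Proof. by case: s. Qed.

Lemma of_real1 : of_real s (1 : R) = 1.
Proof. by case: s. Qed.

Lemma of_real_norm (a : R) : `|of_real s a| = of_real s `|a|.
Proof. by case: s => //=; rewrite normc_def /= expr0n /= addr0 sqrtr_sqr. Qed.

Lemma ab_of_real (a : R) : ab (of_real s a) = `|a|.
Proof. by rewrite /ab of_real_norm of_realK. Qed.

Lemma to_realM_ge0 (a b : K) : 0 <= a -> 0 <= b ->
  to_real (a * b) = to_real a * to_real b.
Proof.
move=> a0 b0; rewrite -{1}(to_realK a0) -{1}(to_realK b0) -of_realM.
by rewrite of_realK.
Qed.

Lemma to_real0 : to_real (0 : K) = 0.
Proof. by rewrite -of_real0 of_realK. Qed.

Lemma to_real_ge0 (a : K) : 0 <= a -> 0 <= to_real a.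
Proof. by move=> /ler_to_real; rewrite to_real0. Qed.

Lemma to_real_eq0 (a : K) : 0 <= a -> to_real a = 0 -> a = 0.
Proof. by move=> a0 a00; rewrite -(to_realK a0) a00 of_real0. Qed.

Lemma to_real_gt0 (a : K) : 0 < a -> 0 < to_real a.
Proof.
move=> a0; rewrite lt_neqAle to_real_ge0 ?ltW// andbT eq_sym.
by apply: contra_neq (lt0r_neq0 a0); apply: to_real_eq0; exact: ltW.
Qed.

Lemma of_real_gt0 (a : R) : 0 < a -> 0 < of_real s a.
Proof.
move=> a0; rewrite lt_neqAle -of_real0 ler_of_real ltW// andbT.
by rewrite (can_eq (@of_realK R s)) eq_sym gt_eqF.
Qed.

Lemma ab_ge0 (a : K) : 0 <= ab a. Proof. exact: to_real_ge0. Qed.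
Lemma abM (a b : K) : ab (a * b) = ab a * ab b.
Proof. by rewrite /ab normrM to_realM_ge0. Qed.
Lemma abD (a b : K) : ab (a + b) <= ab a + ab b.
Proof. by rewrite /ab -to_realD; apply: ler_to_real; exact: ler_normD. Qed.
Lemma abN (a : K) : ab (- a) = ab a. Proof. by rewrite /ab normrN. Qed.
Lemma ab0 : ab 0 = 0. Proof. by rewrite /ab normr0 to_real0. Qed.
Lemma ab1 : ab 1 = 1.
Proof. by rewrite /ab normr1 -of_real1 of_realK. Qed.
Lemma ab_eq0 (a : K) : ab a = 0 -> a = 0.
Proof. by move=> a0; apply/normr0_eq0/to_real_eq0. Qed.
Lemma ab_gt0 (a : K) : a != 0 -> 0 < ab a.
Proof.
move=> a0; rewrite lt_neqAle ab_ge0 andbT eq_sym.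
by apply: contra_neq a0 => /ab_eq0.
Qed.
Lemma abV (a : K) : ab a^-1 = (ab a)^-1.
Proof.
have [->|a0] := eqVneq a 0; first by rewrite invr0 ab0 invr0.
have aa0 := lt0r_neq0 (ab_gt0 a0).
by apply: (mulfI aa0); rewrite -abM !divff ?ab1.
Qed.

Lemma ab_sum (I : Type) (r : seq I) (P : pred I) (F : I -> K) :
  ab (\sum_(i <- r | P i) F i) <= \sum_(i <- r | P i) ab (F i).
Proof.
elim/big_rec2: _ => [|i u v _ uv]; first by rewrite ab0.
by rewrite (le_trans (abD _ _))// lerD2l.
Qed.

Lemma normr_le_sqrtD (a b : R) : `|a| <= Num.sqrt (a ^+ 2 + b ^+ 2).
Proof. by rewrite -sqrtr_sqr ler_wsqrtr// lerDl sqr_ge0. Qed.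

Section norm.
Context {X : normedModType K}.
Implicit Types x y z : X.

Lemma nrE x : of_real s (nr x) = `|x|. Proof. exact: to_realK. Qed.
Lemma nr_ge0 x : 0 <= nr x. Proof. exact: to_real_ge0. Qed.
Lemma nrD x y : nr (x + y) <= nr x + nr y.
Proof. by rewrite /nr -to_realD; apply: ler_to_real; exact: ler_normD. Qed.
Lemma nrN x : nr (- x) = nr x. Proof. by rewrite /nr normrN. Qed.
Lemma nrB x y : nr (x - y) <= nr x + nr y.
Proof. by rewrite (le_trans (nrD _ _))// nrN. Qed.
Lemma nrC x y : nr (x - y) = nr (y - x). Proof. by rewrite -opprB nrN. Qed.
Lemma nrZ a x : nr (a *: x) = ab a * nr x.
Proof. by rewrite /nr normrZ to_realM_ge0. Qed.
Lemma nr0 : nr (0 : X) = 0. Proof. by rewrite /nr normr0 to_real0. Qed.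
Lemma nr_eq0 x : nr x = 0 -> x = 0.
Proof. by move=> x0; apply/normr0_eq0/to_real_eq0. Qed.
Lemma nr_gt0 x : x != 0 -> 0 < nr x.
Proof.
move=> x0; rewrite lt_neqAle nr_ge0 andbT eq_sym.
by apply: contra_neq x0 => /nr_eq0.
Qed.
Lemma nr_tri y x z : nr (x - z) <= nr (x - y) + nr (y - z).
Proof. by rewrite (le_trans _ (nrD _ _))// subrKA. Qed.
Lemma nr_sum (I : Type) (r : seq I) (P : pred I) (F : I -> X) :
  nr (\sum_(i <- r | P i) F i) <= \sum_(i <- r | P i) nr (F i).
Proof.
elim/big_rec2: _ => [|i u v _ uv]; first by rewrite nr0.
by rewrite (le_trans (nrD _ _))// lerD2l.
Qed.
Lemma nr_le_eq0 x : (forall e : R, 0 < e -> nr x <= e) -> x = 0.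
Proof.
move=> xe; apply: nr_eq0; apply/eqP; rewrite eq_le nr_ge0 andbT.
by apply/ler_addgt0Pr => e e0; rewrite add0r xe.
Qed.

Lemma nr_lt x (e : R) : (`|x| < of_real s e) = (nr x < e).
Proof. by rewrite -nrE !lt_neqAle ler_of_real (can_eq (@of_realK R s)). Qed.

Lemma closedP (A : set X) : closed A <->
  forall x, (forall e : R, 0 < e -> exists2 a, A a & nr (x - a) < e) -> A x.
Proof.
split=> [cA x xA|xA].
  apply: cA => B /nbhs_ballP[e /= e0 eB].
  have [|a Aa xa] := xA (to_real e).
    exact: to_real_gt0.
  exists a; split=> //; apply: eB; rewrite -ball_normE /=.
  by rewrite -(to_realK (ltW e0)) nr_lt.
move=> x cx; apply: xA => e e0.
have : nbhs x (ball x (of_real s e)).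
  by apply: nbhsx_ballx; exact: of_real_gt0.
move=> /cx[a [Aa]]; rewrite -ball_normE /= nr_lt => xa.
by exists a.
Qed.

End norm.

Lemma nr_complete (X : completeNormedModType K) (u : nat -> X) :
  (forall e : R, 0 < e -> exists N, forall m n, (N <= m)%N -> (N <= n)%N ->
     nr (u m - u n) < e) ->
  exists l, forall e : R, 0 < e -> exists N, forall n, (N <= n)%N ->
     nr (u n - l) < e.
Proof.
move=> uc; have : cvg (u @ \oo).
  apply: cauchy_cvg; apply/cauchy_ballP => e e0.
  have [|N Nu] := uc (to_real e).
    exact: to_real_gt0.
  exists (u @` [set n | (N <= n)%N], u @` [set n | (N <= n)%N]) => /=.
    by split; exists N => // n /= Nn; exists n.
  move=> [_ _] /= [[m Nm <-] [n Nn <-]]; rewrite -ball_normE /=.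
  by rewrite -(to_realK (ltW e0)) nr_lt Nu.
move=> /cvg_ex[l ul]; exists l => e e0.
have e1 := of_real_gt0 e0.
move/cvgrPdist_lt : ul => /(_ _ e1)[N _ uN]; exists N => n Nn.
by rewrite nrC -nr_lt; apply: uN.
Qed.

Lemma continuous_nrP (X Y : normedModType K) (f : {linear X -> Y}) :
  continuous f <-> exists M : R, forall x, nr (f x) <= M * nr x.
Proof.
split=> [fc|[M fM]].
  have := fc 0 => /cvgrPdist_lt/(_ 1 ltr01).
  rewrite linear0 => /nbhs_ballP[e /= e0 eB].
  have e1 : 0 < to_real e.
    exact: to_real_gt0.
  exists (2 / to_real e) => x; have [->|x0] := eqVneq x 0.
    by rewrite linear0 !nr0 mulr0.
  have nx := nr_gt0 x0.
  set c := of_real s (to_real e / (2 * nr x)).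
  have c0 : 0 < to_real e / (2 * nr x) by rewrite divr_gt0// mulr_gt0.
  have : nr (f (c *: x)) < 1.
    rewrite -nr_lt of_real1 -normrN -[- _]add0r; apply: eB.
    rewrite -ball_normE /= sub0r normrN -(to_realK (ltW e0)) nr_lt nrZ.
    rewrite ab_of_real gtr0_norm//.
    have -> : to_real e / (2 * nr x) * nr x = to_real e / 2.
      by field; rewrite gt_eqF.
    by rewrite ltr_pdivrMr// ltr_pMr// ltr1n.
  rewrite linearZ nrZ ab_of_real gtr0_norm//.
  rewrite mulrC -ltr_pdivlMr// div1r invf_div => /ltW.
  by rewrite mulrAC.
have M1 : 0 < `|M| + 1 by rewrite ltr_wpDl.
move=> x; apply/cvgrPdist_lt => e e0.
have e1 : 0 < to_real e.
  exact: to_real_gt0.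
apply/nbhs_ballP; exists (of_real s (to_real e / (`|M| + 1))) => /=.
  by apply: of_real_gt0; rewrite divr_gt0.
move=> y; rewrite -ball_normE /= nr_lt => xy.
rewrite -(to_realK (ltW e0)) -raddfB /= nr_lt (le_lt_trans (fM _))//.
rewrite (@le_lt_trans _ _ ((`|M| + 1) * nr (x - y)))//.
  by rewrite ler_wpM2r ?nr_ge0// (le_trans (ler_norm M))// lerDl.
by rewrite mulrC -ltr_pdivlMr.
Qed.

End real_norm.

(** * Continuous functionals separate points *)

Definition bounded_functional (R : realType) (s : scalar_kind)
    (X : normedModType (scalars R s)) (f : X -> scalars R s) : Prop :=
  (forall a x y, f (a *: x + y) = a * f x + f y) /\
  exists M : R, forall x, ab (f x) <= M * nr x.

Section hahn_banach.
Context {R : realType} {s : scalar_kind}.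
Local Notation K := (scalars R s).
Context {X : normedModType K}.
Implicit Types (x y : X) (G : set (X * R)).

Let rs (r : R) x := of_real s r *: x.

Let rsA r q x : rs r (rs q x) = rs (r * q) x.
Proof. by rewrite /rs scalerA of_realM. Qed.
Let rsDl r q x : rs (r + q) x = rs r x + rs q x.
Proof. by rewrite /rs of_realD scalerDl. Qed.
Let rsDr r x y : rs r (x + y) = rs r x + rs r y.
Proof. by rewrite /rs scalerDr. Qed.
Let rs1 x : rs 1 x = x. Proof. by rewrite /rs of_real1 scale1r. Qed.
Let rs0 x : rs 0 x = 0. Proof. by rewrite /rs of_real0 scale0r. Qed.
Let rsN1 x : rs (- 1) x = - x.
Proof. by rewrite /rs of_realN of_real1 scaleN1r. Qed.
Let nr_rs r x : nr (rs r x) = `|r| * nr x.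
Proof. by rewrite nrZ ab_of_real. Qed.

(** Graphs of real-linear functionals, on real subspaces, below the norm; the
    last clause is what pins the functional at x0 without excluding the empty
    graph, which is the union of the empty chain. *)
Let partial_functional x0 G :=
  [/\ forall p, G p -> p.2 <= nr p.1,
      forall r p q, G p -> G q -> G (rs r p.1 + q.1, r * p.2 + q.2) &
      G !=set0 -> G (x0, nr x0)].

(** The value c at x1 must lie above all p.2 - |p.1 - x1| and below all
    |p.1 + x1| - p.2; the triangle inequality leaves room for it. *)
Let extend x0 G x1 : partial_functional x0 G -> G !=set0 ->
  exists c, partial_functional x0
    [set p | exists q r, G q /\ p = (q.1 + rs r x1, q.2 + r * c)].
Proof.
move=> [Gle Glin G0] Gn0.
pose E := [set p.2 - nr (p.1 - x1) | p in G].
have cross p q : G p -> G q -> p.2 - nr (p.1 - x1) <= nr (q.1 + x1) - q.2.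
  move=> Gp Gq; have := Gle _ (Glin 1 _ _ Gp Gq) => /=; rewrite rs1 mul1r.
  have := nrD (p.1 - x1) (q.1 + x1); rewrite addrACA addNr addr0.
  lra.
have [p0 Gp0] := Gn0.
have ubE : has_ubound E.
  by exists (nr (p0.1 + x1) - p0.2) => _ [p Gp <-]; exact: cross.
have lo p : G p -> p.2 - nr (p.1 - x1) <= sup E.
  by move=> Gp; apply: (ub_le_sup ubE); exists p.
have hi p : G p -> sup E <= nr (p.1 + x1) - p.2.
  move=> Gp; apply: ge_sup; first by exists (p0.2 - nr (p0.1 - x1)), p0.
  by move=> _ [q Gq <-]; exact: cross.
have G00 : G (0, 0).
  by have := Glin (- 1) _ _ Gp0 Gp0; rewrite rsN1 mulN1r !addNr.
have Gs r p : G p -> G (rs r p.1, r * p.2).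
  by move=> Gp; have := Glin r _ _ Gp G00; rewrite !addr0.
exists (sup E); split.
- move=> _ [p [r [Gp ->]]] /=.
  have [r0|r0|<-] := ltgtP 0 r.
  + have := hi _ (Gs r^-1 _ Gp) => /= h.
    have -> : p.1 + rs r x1 = rs r (rs r^-1 p.1 + x1).
      by rewrite rsDr rsA mulfV ?gt_eqF// rs1.
    rewrite nr_rs gtr0_norm//.
    have : r * sup E <= r * (nr (rs r^-1 p.1 + x1) - r^-1 * p.2).
      by rewrite ler_pM2l.
    by rewrite mulrBr mulrA mulfV ?gt_eqF// mul1r; lra.
  + have := lo _ (Gs (- r)^-1 _ Gp) => /= h.
    have r1 : 0 < - r by rewrite oppr_gt0.
    have -> : p.1 + rs r x1 = rs (- r) (rs (- r)^-1 p.1 - x1).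
      rewrite rsDr rsA mulfV ?gt_eqF// rs1 -rsN1 rsA mulrN1 opprK//.
    rewrite nr_rs gtr0_norm//.
    have : - r * ((- r)^-1 * p.2 - nr (rs (- r)^-1 p.1 - x1)) <= - r * sup E.
      by rewrite ler_pM2l.
    by rewrite mulrBr mulrA mulfV ?gt_eqF// mul1r; lra.
  + by rewrite rs0 mul0r !addr0; apply: Gle.
- move=> r _ _ [p [a [Gp ->]]] [q [b [Gq ->]]] /=.
  exists (rs r p.1 + q.1, r * p.2 + q.2), (r * a + b); split; first exact: Glin.
  by congr (_, _) => /=; [rewrite rsDr rsDl rsA addrACA|ring].
- by move=> _; exists (x0, nr x0), 0; rewrite rs0 mul0r !addr0; split; [exact: G0|].
Qed.

Lemma real_functional x0 : exists u : X -> R,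
  [/\ u x0 = nr x0, forall x, `|u x| <= nr x &
      forall r x y, u (of_real s r *: x + y) = r * u x + u y].
Proof.
have [|G [PG Gmax]] := @Zorn_bigcup _ (partial_functional x0).
  move=> F FP tot; split.
  - by move=> p [G FG Gp]; have [+ _ _] := FP _ FG; apply.
  - move=> r p q [G FG Gp] [H FH Hq].
    have [GH|HG] := tot _ _ FG FH.
      by have [_ + _] := FP _ FH => /(_ r p q); exists H => //; eauto.
    by have [_ + _] := FP _ FG => /(_ r p q); exists G => //; eauto.
  - by move=> [p [G FG Gp]]; exists G => //; have [_ _] := FP _ FG; apply; exists p.
have Gn0 : G !=set0.
  apply: contrapT => /nonemptyPn G0.
  apply: (Gmax [set p | exists r, p = (rs r x0, r * nr x0)]).
    rewrite G0; split=> //; move/(_ (x0, nr x0)); apply.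
    by exists 1; rewrite rs1 mul1r.
  split.
  - move=> _ [r ->] /=; rewrite nr_rs ler_wpM2r ?nr_ge0//; exact: ler_norm.
  - move=> r _ _ [a ->] [b ->] /=; exists (r * a + b).
    by rewrite rsA -rsDl mulrDl mulrA.
  - by move=> _; exists 1; rewrite rs1 mul1r.
have [Gle Glin /(_ Gn0) Gx0] := PG.
have [p0 Gp0] := Gn0.
have G00 : G (0, 0).
  by have := Glin (- 1) _ _ Gp0 Gp0; rewrite rsN1 mulN1r !addNr.
have Gtot x : exists t, G (x, t).
  apply: contrapT => nx; have [c Pc] := extend x PG Gn0.
  apply: Gmax Pc; split.
    by move=> [y t] Gy; exists (y, t), 0; rewrite rs0 mul0r !addr0.
  move/(_ (x, c)) => Gxc; apply: nx; exists c; apply: Gxc.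
  by exists (0, 0), 1; rewrite rs1 mul1r !add0r.
have [u Gu] := choice Gtot.
have Gle0 x t v : G (x, t) -> G (x, v) -> v <= t.
  move=> Gt Gv; have := Gle _ (Glin (- 1) _ _ Gt Gv).
  by rewrite /= rsN1 addNr nr0; lra.
have Guniq x t v : G (x, t) -> G (x, v) -> t = v.
  by move=> Gt Gv; apply/eqP; rewrite eq_le; apply/andP; split; apply: Gle0; eauto.
have ulin r x y : u (rs r x + y) = r * u x + u y.
  by apply: Guniq (Gu _) _; exact: (Glin r _ _ (Gu x) (Gu y)).
exists u; split=> //; first exact: Guniq (Gu _) Gx0.
move=> x; rewrite ler_norml; have := Gle _ (Gu x); rewrite /= => ->; rewrite andbT.
have := Gle _ (Gu (- x)); rewrite /= nrN.
have u0 : u 0 = 0 by apply: Guniq (Gu _) G00.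
have := ulin (- 1) x 0; rewrite rsN1 u0 !addr0 => ->.
lra.
Qed.

End hahn_banach.

(** The complex functional with real part u is x |-> u x - i u (i x). *)
Lemma separating_functional (R : realType) (s : scalar_kind)
    (X : normedModType (scalars R s)) (x0 : X) : x0 != 0 ->
  exists2 f : X -> scalars R s, bounded_functional f & f x0 != 0.
Proof.
move=> x00; have [u [ux0 ub ulin]] := real_functional x0.
have ux0_neq0 : u x0 != 0 by rewrite ux0 gt_eqF// nr_gt0.
case: s X x0 x00 u ux0 ub ulin ux0_neq0 => X x0 x00 u ux0 ub ulin ux0_neq0.
  by exists u => //; split => //; exists 1 => x; rewrite mul1r; exact: ub.
pose J : R[i] := 'i%C.
exists (fun x => (u x)%:C%C - J * (u (J *: x))%:C%C); last first.
  apply: contra_neq ux0_neq0 => /(congr1 (@complex.Re R)) /=.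
  by rewrite mul0r mulr0 subrr subr0.
have u0 : u 0 = 0 by have := ulin 1 0 0; rewrite scaler0 addr0; lra.
have uD x y : u (x + y) = u x + u y.
  by have := ulin 1 x y; rewrite /= scale1r mul1r.
have uZ (r : R) x : u (r%:C%C *: x) = r * u x.
  by have := ulin r x 0; rewrite u0 !addr0.
have JJ : J * J = - 1 by apply/eqP; rewrite eq_complex /= !(mul0r, mulr0, mulr1, add0r, addr0, sub0r) oppr0 !eqxx.
have uZ' (a : R[i]) x :
    u (a *: x) = complex.Re a * u x + complex.Im a * u (J *: x).
  rewrite -!uZ -uD scalerA -scalerDl; congr (u (_ *: _)).
  case: a => a b; apply/eqP; rewrite eq_complex /=.
  by rewrite !(mul0r, mulr0, mulr1, add0r, addr0, subr0) !eqxx.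
split.
  move=> a x y; rewrite scalerDr !uD scalerA (uZ' a) (uZ' (J * a)).
  move: (u x) (u (J *: x)) (u y) (u (J *: y)) => p q r t.
  apply/eqP; rewrite eq_complex; case: a => a b /=.
  by apply/andP; split; apply/eqP; ring.
exists 2 => x.
have J1 : @ab _ ComplexScalars J = 1.
  by rewrite /ab /to_real /= expr0n expr1n /= add0r sqrtr1.
rewrite (le_trans (abD _ _))// abN abM J1 mul1r mulr_natl mulr2n.
rewrite (@ab_of_real _ ComplexScalars) (@ab_of_real _ ComplexScalars) lerD//.
by rewrite (le_trans (ub _))// nrZ J1 mul1r.
Qed.

(** * Infinite dimension and biorthogonal systems *)

(** Dependent choice for an invariant P and a transition relation Q that may
    depend on the stage. *)
Lemma dependent_sequence (S : Type) (P : nat -> S -> Prop)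
    (Q : nat -> S -> S -> Prop) (s0 : S) :
  P 0%N s0 -> (forall n s, P n s -> exists s', P n.+1 s' /\ Q n s s') ->
  exists f : nat -> S, f 0%N = s0 /\ forall n, P n (f n) /\ Q n (f n) (f n.+1).
Proof.
move=> P0 PS.
have step (p : nat * S) : exists s', P p.1 p.2 -> P p.1.+1 s' /\ Q p.1 p.2 s'.
  have [/PS[s' Ps']|nP] := pselect (P p.1 p.2); first by exists s'.
  by exists p.2.
have [F FP] := choice step.
pose f := fix f n := if n is m.+1 then F (m, f m) else s0.
have Pf n : P n (f n).
  by elim: n => [|n IH] //=; exact: (FP (n, f n) IH).1.
by exists f; split=> // n; split=> //; exact: (FP (n, f n) (Pf n)).2.
Qed.

Section dimension.
Context {K : numFieldType} {E : lmodType K}.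
Implicit Types (Y : set E) (f : E -> K).

Definition linear_on Y f := forall a x y, Y x -> Y y ->
  f (a *: x + y) = a * f x + f y.

Lemma linear_subspaceZ Y a x : linear_subspace Y -> Y x -> Y (a *: x).
Proof. by case=> Y0 YS Yx; have := YS a x 0 Yx Y0; rewrite addr0. Qed.

Lemma linear_subspaceD Y x y : linear_subspace Y -> Y x -> Y y -> Y (x + y).
Proof. by case=> Y0 YS Yx Yy; have := YS 1 x y Yx Yy; rewrite scale1r. Qed.

Lemma linear_subspaceB Y x y : linear_subspace Y -> Y x -> Y y -> Y (x - y).
Proof.
case=> Y0 YS Yx Yy; have := YS (-1) y x Yy Yx.
by rewrite scaleN1r addrC.
Qed.

Lemma linear_subspace_sum Y (I : Type) (r : seq I) (P : pred I) (F : I -> E) :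
  linear_subspace Y -> (forall i, P i -> Y (F i)) ->
  Y (\sum_(i <- r | P i) F i).
Proof.
move=> YS YF; apply: big_ind => //; first exact: YS.1.
by move=> x y; exact: linear_subspaceD.
Qed.

Lemma infinite_dimensional_nonzero Y : linear_subspace Y ->
  infinite_dimensional Y -> exists2 y, Y y & y != 0.
Proof.
move=> YS Yinf; apply: contrapT => nY; apply: Yinf; exists 0%N, (fun=> 0).
apply/seteqP; split=> [y Yy|_ [c _ <-]]; last by rewrite big_ord0; exact: YS.1.
exists (fun=> 0) => //; rewrite big_ord0; apply/esym/eqP.
by apply: contrapT => /negP y0; apply: nY; exists y.
Qed.

Lemma linear_subspace_ker Y f : linear_subspace Y -> linear_on Y f ->
  linear_subspace (Y `&` [set y | f y = 0]).
Proof.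
move=> YS fY; split.
  split; first exact: YS.1.
  have := fY (-1) 0 0 YS.1 YS.1.
  by rewrite scaler0 addr0 mulN1r addNr.
move=> a x y [Yx fx] [Yy fy]; split; first exact: YS.2.
by rewrite /= fY// fx fy mulr0 addr0.
Qed.

Lemma infinite_dimensional_ker Y f : linear_subspace Y -> linear_on Y f ->
  infinite_dimensional Y -> infinite_dimensional (Y `&` [set y | f y = 0]).
Proof.
move=> YS fY Yinf [n [v Yv]]; have [f0|] := pselect (forall y, Y y -> f y = 0).
  apply: Yinf; exists n, v; rewrite -Yv.
  by apply/seteqP; split=> [y Yy|y []] //; split=> //; exact: f0.
move=> /existsNP[y0 /not_implyP[Yy0 /eqP fy0]].
have Yfv c : (Y `&` [set y | f y = 0]) (\sum_i c i *: v i) by rewrite Yv; exists c.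
apply: Yinf; exists n.+1, (fun i => if unlift ord0 i is Some j then v j else y0).
apply/seteqP; split=> [y Yy|_ [c _ <-]].
  have : (Y `&` [set y | f y = 0]) (- (f y / f y0) *: y0 + y).
    split; first exact: YS.2.
    by rewrite /= fY// mulNr divfK// addNr.
  rewrite Yv => -[c _ cE].
  exists (fun i => if unlift ord0 i is Some j then c j else f y / f y0) => //.
  rewrite big_ord_recl unlift_none.
  under eq_bigr do rewrite liftK.
  by rewrite cE scaleNr addrA subrr add0r.
rewrite big_ord_recl unlift_none; apply: YS.2 => //.
under eq_bigr do rewrite liftK.
by have [] := Yfv (fun i => c (lift ord0 i)).
Qed.

Lemma infinite_dimensional_kers Y (f : nat -> E -> K) n : linear_subspace Y ->
  (forall i, (i < n)%N -> linear_on Y (f i)) -> infinite_dimensional Y ->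
  exists y, [/\ Y y, y != 0 & forall i, (i < n)%N -> f i y = 0].
Proof.
elim: n Y => [|n IH] Y YS fY Yinf.
  by have [y Yy y0] := infinite_dimensional_nonzero YS Yinf; exists y.
have fn : linear_on Y (f n) by exact: fY.
have [|i|//|y [[Yy fny] y0 fy]] := IH (Y `&` [set y | f n y = 0]).
- exact: linear_subspace_ker.
- by move=> i_n a x y [Yx _] [Yy _]; apply: fY => //; exact: ltnW.
- exact: infinite_dimensional_ker.
by exists y; split=> // i; rewrite ltnS leq_eqVlt => /orP[/eqP->|/fy].
Qed.

(** n.+1 vectors in the span of n are linearly dependent: the matrix of their
    coefficients has a nonzero left kernel. *)
Lemma infinite_dimensional_free Y (v : nat -> E) : (forall k, Y (v k)) ->
  (forall n (c : nat -> K), \sum_(k < n) c k *: v k = 0 ->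
     forall k, (k < n)%N -> c k = 0) ->
  infinite_dimensional Y.
Proof.
move=> Yv vfree [n [w Yw]].
have vw k : exists c : 'I_n -> K, v k = \sum_i c i *: w i.
  by have := Yv k; rewrite Yw => -[c _ <-]; exists c.
have [C CE] := choice vw.
pose A := \matrix_(k < n.+1, i < n) C k i.
have : kermx A != 0.
  rewrite -mxrank_eq0 mxrank_ker subn_eq0 -ltnNge ltnS.
  exact: rank_leq_col.
move=> /rowV0Pn[u /sub_kermxP uA u0].
have uv : \sum_(k < n.+1) u 0 (inord k) *: v k = 0.
  under eq_bigr => k _ do rewrite CE scaler_sumr inord_val.
  rewrite exchange_big /= big1 => // i _.
  under eq_bigr => k _ do rewrite scalerA.
  rewrite -scaler_suml; move/matrixP : uA => /(_ 0 i).
  rewrite !mxE => uA; rewrite -[X in X *: _](_ : 0 = _) ?scale0r// -[LHS]uA.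
  by apply: eq_bigr => k _; rewrite mxE.
move/eqP: u0; apply; apply/rowP => k; rewrite mxE.
have := vfree n.+1 (fun k => u 0 (inord k)) uv k (ltn_ord k).
by rewrite inord_val.
Qed.

End dimension.

Section functionals.
Context {R : realType} {s : scalar_kind}.
Local Notation K := (scalars R s).
Context {X : normedModType K}.
Implicit Types (f g : X -> K).

Lemma functional0 f : bounded_functional f -> f 0 = 0.
Proof.
case=> fl _; have := fl (-1) 0 0.
by rewrite scaler0 addr0 mulN1r addNr.
Qed.

Lemma functionalD f x y : bounded_functional f -> f (x + y) = f x + f y.
Proof. by case=> fl _; have := fl 1 x y; rewrite scale1r mul1r. Qed.

Lemma functionalZ f a x : bounded_functional f -> f (a *: x) = a * f x.
Proof. by move=> bf; have := bf.1 a x 0; rewrite (functional0 bf) !addr0. Qed.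

Lemma functionalB f x y : bounded_functional f -> f (x - y) = f x - f y.
Proof.
by move=> bf; rewrite -scaleN1r addrC bf.1 mulN1r addrC.
Qed.

Lemma functional_sum f (I : Type) (r : seq I) (P : pred I) (F : I -> X) :
  bounded_functional f -> f (\sum_(i <- r | P i) F i) = \sum_(i <- r | P i) f (F i).
Proof.
move=> bf; apply: (big_morph f (id1 := 0) (op1 := +%R)).
  by move=> x y; exact: functionalD.
exact: functional0.
Qed.

Lemma functional_bound f : bounded_functional f ->
  exists2 M : R, 0 < M & forall x, ab (f x) <= M * nr x.
Proof.
move=> [_ [M fM]]; exists (`|M| + 1); first by rewrite ltr_wpDl.
move=> x; rewrite (le_trans (fM x))// ler_wpM2r ?nr_ge0//.
by rewrite (le_trans (ler_norm M))// lerDl.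
Qed.

Lemma bounded_functional_comb a b f g : bounded_functional f ->
  bounded_functional g -> bounded_functional (fun x => a * f x + b * g x).
Proof.
move=> bf bg; split=> [c x y|]; first by rewrite bf.1 bg.1; ring.
have [M _ fM] := functional_bound bf; have [N _ gN] := functional_bound bg.
exists (ab a * M + ab b * N) => x.
rewrite (le_trans (abD _ _))// !abM mulrDl -!mulrA.
by rewrite lerD// ler_wpM2l ?ab_ge0.
Qed.

Lemma functional_closed f x (c : K) (A : set X) : bounded_functional f ->
  (forall a, A a -> f a = c) ->
  (forall e : R, 0 < e -> exists2 a, A a & nr (x - a) < e) -> f x = c.
Proof.
move=> bf Ac xA; have [M M0 fM] := functional_bound bf.
apply/eqP; rewrite -subr_eq0; apply/eqP/ab_eq0/eqP.
rewrite eq_le ab_ge0 andbT; apply/ler_addgt0Pr => e e0; rewrite add0r.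
have [|a Aa xa] := xA (e / M); first by rewrite divr_gt0.
rewrite -(Ac _ Aa) -functionalB// (le_trans (fM _))//.
by rewrite mulrC -ler_pdivlMr// ltW.
Qed.

(** The diagonal entry of each row clears the entries before it, so a
    triangular system becomes biorthogonal by Gaussian elimination. *)
Lemma triangular_biorthogonal (x : nat -> X) (phi : nat -> X -> K) :
  (forall n, bounded_functional (phi n)) -> (forall n, phi n (x n) != 0) ->
  (forall n m, (n < m)%N -> phi n (x m) = 0) ->
  exists g : nat -> X -> K, (forall n, bounded_functional (g n)) /\
    forall n m, g n (x m) = (n == m)%:R.
Proof.
move=> bphi phi1 phi0.
(* each step clears the value at one more vector before x n *)
have elim n j : (j <= n)%N -> exists g, [/\ bounded_functional g, g (x n) = 1 &
    forall m, (n - j <= m)%N -> m != n -> g (x m) = 0].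
  elim: j => [_|j IH jn].
    exists (fun y => phi n y / phi n (x n)); split=> [||m nm mn].
    - have := bounded_functional_comb (phi n (x n))^-1 0 (bphi n) (bphi n).
      by congr bounded_functional; apply/funext => y; rewrite mul0r addr0 mulrC.
    - by rewrite divff.
    - by rewrite phi0 ?mul0r// ltn_neqAle eq_sym mn -(subn0 n).
  have [g [bg g1 g0]] := IH (ltnW jn).
  pose i := (n - j.+1)%N.
  exists (fun y => 1 * g y + (- (g (x i) / phi i (x i))) * phi i y); split.
  - exact: bounded_functional_comb.
  - have i_n : (i < n)%N by rewrite /i ltn_subrL /= (leq_trans _ jn).
    by rewrite g1 (phi0 _ _ i_n) mulr0 mulr1 addr0.
  - move=> m im mn; have [->|mi] := eqVneq m i.
      by rewrite mul1r mulNr divfK// subrr.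
    have im' : (i < m)%N by rewrite ltn_neqAle eq_sym mi.
    rewrite (phi0 _ _ im') mulr0 addr0 mul1r g0//.
    by rewrite (leq_trans _ im')// /i -subSn ?subSS.
have [g gP] := choice (fun n => elim n n (leqnn n)).
exists g; split=> [n|n m]; have [bg g1 g0] := gP n => //.
by have [->|nm] := eqVneq n m; [have [] := gP m|rewrite g0// ?subnn// eq_sym].
Qed.

(** Functionals obtained from the Hahn-Banach theorem are normalised on one
    vector at a time, and the next vector is taken in their kernels. *)
Lemma biorthogonal_system (T : set X) (f : nat -> X -> K) :
  linear_subspace T -> infinite_dimensional T ->
  (forall n, bounded_functional (f n)) ->
  exists (t : nat -> X) (h : nat -> X -> K),
    [/\ forall k, T (t k), forall k i, (i < k)%N -> f i (t k) = 0,
        forall k, bounded_functional (h k) &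
        forall k l, h k (t l) = (k == l)%:R].
Proof.
move=> TS Tinf bf.
pose St := (nat -> X * (X -> K))%type.
pose ok (n : nat) (w : St) := forall k, (k < n)%N ->
  [/\ T (w k).1, forall i, (i < k)%N -> f i (w k).1 = 0,
      bounded_functional (w k).2, (w k).2 (w k).1 != 0 &
      forall l, (l < k)%N -> (w l).2 (w k).1 = 0].
pose agree (n : nat) (w w' : St) := forall k, (k < n)%N -> w' k = w k.
have [||w [_ wP]] := @dependent_sequence _ ok agree (fun=> (0, fun=> 0)).
- by [].
- move=> n w wok.
  (* the first n of the f i, followed by the n functionals already chosen *)
  have [|y [Ty y0 fy]] := infinite_dimensional_kers
      (f := fun i => if (i < n)%N then f i else (w (i - n)%N).2) (n := n + n) TS _ Tinf.
    move=> i i_n a u v _ _; case: ltnP => ni; first by case: (bf i).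
    have [|_ _ [+ _] _ _] := wok (i - n)%N; last exact.
    by rewrite ltn_subLR.
  have [phi bphi phiy] := separating_functional y0.
  exists (fun k => if k == n then (y, phi) else w k); split=> k; last first.
    by move=> kn; rewrite ltn_eqF.
  rewrite ltnS leq_eqVlt => /orP[/eqP ->|kn].
    rewrite eqxx; split=> //= i i_n.
      by have := fy i; rewrite i_n; apply; exact: ltn_addr.
    have nin : (n + i < n)%N = false by rewrite ltnNge leq_addr.
    rewrite ltn_eqF//; have := fy (n + i)%N.
    by rewrite nin addKn; apply; rewrite ltn_add2l.
  have [? ? ? ? wl] := wok k kn; rewrite ltn_eqF//; split=> // l lk.
  by rewrite ltn_eqF ?wl// (ltn_trans lk).
pose t k := (w k.+1 k).1; pose phi k := (w k.+1 k).2.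
have wE k n : (k < n)%N -> w n k = w k.+1 k.
  elim: n => // n IH; rewrite ltnS leq_eqVlt => /orP[/eqP <-//|kn].
  by rewrite (wP n).2// IH.
have tP k := (wP k.+1).1 k (ltnSn k).
have [|||h [bh ht]] := @triangular_biorthogonal t phi.
- by move=> n; have [] := tP n.
- by move=> n; have [] := tP n.
- by move=> n m nm; have [_ _ _ _ /(_ n nm)] := tP m; rewrite wE// ltnS ltnW.
exists t, h; split=> //; first by move=> k; have [] := tP k.
by move=> k; have [] := tP k.
Qed.

End functionals.

(** * Maurey's selection of intertwining-free sequences *)

Section combinations.
Context {K : numFieldType} {X : lmodType K}.
Implicit Types (D : set K) (z : nat -> X) (p q : {poly K}).

(** Finite families of coefficients are encoded as polynomials. *)
Definition comb z p : X := \sum_(i < size p) p`_i *: z i.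

Lemma comb_widen z p n : (size p <= n)%N -> comb z p = \sum_(i < n) p`_i *: z i.
Proof.
move=> pn; rewrite /comb (big_ord_widen n (fun i => p`_i *: z i) pn) big_mkcond.
apply: eq_bigr => i _; case: ltnP => // ip.
by rewrite nth_default// scale0r.
Qed.

Lemma combP z a p q : comb z (a *: p + q) = a *: comb z p + comb z q.
Proof.
set n := maxn (size p) (size q).
have pn : (size p <= n)%N by rewrite leq_maxl.
have qn : (size q <= n)%N by rewrite leq_maxr.
have apn : (size (a *: p + q)%R <= n)%N.
  rewrite (leq_trans (size_polyD _ _))// geq_max qn andbT.
  exact: leq_trans (size_scale_leq _ _) pn.
rewrite (comb_widen z pn) (comb_widen z qn) (comb_widen z apn).
rewrite scaler_sumr -big_split; apply: eq_bigr => i _.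
by rewrite coefD coefZ scalerDl scalerA.
Qed.

Lemma comb_poly z n (c : nat -> K) :
  comb z (\poly_(i < n) c i) = \sum_(i < n) c i *: z i.
Proof.
rewrite (comb_widen z (size_poly _ _)); apply: eq_bigr => i _.
by rewrite coef_poly ltn_ord.
Qed.

Lemma comb0 z : comb z 0 = 0. Proof. by rewrite /comb size_poly0 big_ord0. Qed.

Definition coefs_in D p := forall i, D p`_i.

Definition module_over D (Z : set X) :=
  Z 0 /\ forall d x y, D d -> Z x -> Z y -> Z (d *: x + y).

Definition span_over D z : set X := [set comb z p | p in coefs_in D].

Record subring_set D : Prop := SubringSet {
  subring_set0 : D 0 ; subring_set1 : D 1 ;
  subring_setD : forall a b, D a -> D b -> D (a + b) ;
  subring_setN : forall a, D a -> D (- a) ;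
  subring_setM : forall a b, D a -> D b -> D (a * b) }.

Lemma module_over_sum D (Z : set X) (I : Type) (r : seq I) (P : pred I)
    (c : I -> K) (F : I -> X) : module_over D Z -> (forall i, D (c i)) ->
  (forall i, P i -> Z (F i)) -> Z (\sum_(i <- r | P i) c i *: F i).
Proof.
move=> [Z0 ZS] Dc ZF; elim/big_rec: _ => // i x Pi Zx.
by apply: ZS => //; exact: ZF.
Qed.

Lemma module_overI D (Y Z : set X) : module_over D Y -> module_over D Z ->
  module_over D (Y `&` Z).
Proof.
move=> [Y0 YS] [Z0 ZS]; split=> // d x y Dd [Yx Zx] [Yy Zy].
by split; [exact: YS|exact: ZS].
Qed.

Lemma span_over_module D z : subring_set D -> module_over D (span_over D z).
Proof.
move=> DR; split.
  by exists 0; rewrite ?comb0// => i; rewrite coef0; exact: subring_set0.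
move=> d _ _ Dd [p Dp <-] [q Dq <-]; exists (d *: p + q); last exact: combP.
move=> i; rewrite coefD coefZ; apply: subring_setD => //.
exact: subring_setM.
Qed.

Lemma span_over_sub D (Z : set X) z : module_over D Z -> (forall i, Z (z i)) ->
  span_over D z `<=` Z.
Proof.
move=> ZM Zz _ [p Dp <-]; rewrite /comb.
by apply: (module_over_sum _ ZM) => i *; [exact: Dp|exact: Zz].
Qed.

Lemma span_over_gen D z n : subring_set D -> span_over D z (z n).
Proof.
move=> DR; exists 'X^n.
  by move=> i; rewrite coefXn; case: (_ == _); [exact: subring_set1|exact: subring_set0].
rewrite (comb_widen z (n := n.+1)) ?size_polyXn// big_ord_recr /= big1.
  by rewrite coefXn eqxx scale1r add0r.
by move=> i _; rewrite coefXn ltn_eqF ?scale0r.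
Qed.

End combinations.

Section intertwining.
Context {K : numFieldType} {X : lmodType K}.
Context (D : set K) (V : set X) (f : nat -> X -> K) (v : nat -> X).
Context (Bad : X -> X -> Prop).
Context (DR : subring_set D) (VM : module_over D V).
Context (flin : forall n a x y, f n (a *: x + y) = a * f n x + f n y).
Context (Vf : forall x, V x -> (forall i, f i x = 0) -> x = 0).
Context (vV : forall x, V x -> exists n, v n = x).
Context (Badsym : forall x y, Bad x y -> Bad y x).
Implicit Types (E F U Z : set X).

Definition tail n x := forall i, (i < n)%N -> f i x = 0.

(** The tails have finite codimension, so meeting all of them nontrivially
    expresses infinite dimension in a form that diagonal arguments preserve. *)
Definition large Z :=
  [/\ module_over D Z, Z `<=` V & forall n, exists u, [/\ Z u, u != 0 & tail n u]].

(** The leading coordinate of z n lies between k n and k n.+1: this makes the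
    z n linearly independent, and the span of the z i with i >= n lies in the
    n-th tail. *)
Definition blocks (z : nat -> X) (k : nat -> nat) := forall n,
  [/\ V (z n), tail (k n) (z n), ~ tail (k n.+1) (z n) & (k n < k n.+1)%N].

(** What inclusion up to finite codimension gives for large sets. *)
Definition almost_subset Z Z' :=
  forall U, large U -> U `<=` Z -> large (U `&` Z').

Let tail_le m n x : (m <= n)%N -> tail n x -> tail m x.
Proof. by move=> mn nx i im; apply: nx; exact: leq_trans im mn. Qed.

Lemma large_escape Z n : large Z ->
  exists u k, [/\ Z u, tail n u, ~ tail k u & (n < k)%N].
Proof.
move=> [ZM ZV Zn]; have [u [Zu u0 nu]] := Zn n.
have [i fi] : exists i, f i u <> 0.
  apply: contrapT => nf; move/eqP: u0; apply; apply: Vf; first exact: ZV.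
  by move=> i; apply: contrapT => fi; apply: nf; exists i.
exists u, (n + i).+1; split=> //; last by rewrite ltnS leq_addr.
by move=> /(_ i); rewrite ltnS leq_addl => /(_ isT).
Qed.

Lemma f_sum n (I : Type) (r : seq I) (P : pred I) (c : I -> K) (F : I -> X) :
  f n (\sum_(i <- r | P i) c i *: F i) = \sum_(i <- r | P i) c i * f n (F i).
Proof.
have f0 : f n 0 = 0.
  by have := flin n (-1) 0 0; rewrite scaler0 addr0 mulN1r addNr.
by elim/big_rec2: _ => // i x y Pi <-; rewrite flin.
Qed.

Lemma blocks_homo z k : blocks z k -> {homo k : m n / (m <= n)%N}.
Proof.
move=> zk m n; elim: n => [|n IH]; first by rewrite leqn0 => /eqP ->.
rewrite leq_eqVlt => /orP[/eqP -> //|]; rewrite ltnS => /IH /leq_trans; apply.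
by have [_ _ _ /ltnW] := zk n.
Qed.

Lemma blocks_ge z k n : blocks z k -> (n <= k n)%N.
Proof.
move=> zk; elim: n => // n /leq_ltn_trans; apply.
by have [_ _ _] := zk n.
Qed.

(** By induction on i: a functional f l with k i <= l < k i.+1 that does not
    kill z i kills the combination and all later blocks. *)
Lemma blocks_coef0 z k p n : blocks z k -> tail (k n) (comb z p) ->
  forall i, (i < n)%N -> p`_i = 0.
Proof.
move=> zk nu; elim/ltn_ind => i IH i_n.
have [pi|ip] := leqP (size p) i; first by rewrite nth_default.
have [_ _ /existsNP[l /not_implyP[lk /eqP fl0]] _] := zk i.
have := nu l (leq_trans lk (blocks_homo zk i_n)).
rewrite /comb f_sum (bigD1 (Ordinal ip)) //= big1 => [/eqP|j ji].
  by rewrite addr0 mulf_eq0 (negPf fl0) orbF => /eqP.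
have [jlt|ilt] := ltnP j i; first by rewrite IH ?mul0r// (ltn_trans jlt).
have {ilt} ilt : (i < j)%N by rewrite ltn_neqAle ilt andbT eq_sym.
have [_ tj _ _] := zk j; rewrite tj ?mulr0//.
exact: leq_trans lk (blocks_homo zk ilt).
Qed.

Lemma large_span z k : blocks z k -> large (span_over D z).
Proof.
move=> zk; split; first exact: span_over_module.
  by apply: span_over_sub => // i; have [] := zk i.
move=> n; exists (z n); have [_ tn nt _] := zk n; split.
- exact: span_over_gen.
- apply/eqP => zn0; apply: nt; rewrite zn0 => i _.
  by have := flin i (-1) 0 0; rewrite scaler0 addr0 mulN1r addNr.
- exact: tail_le (blocks_ge n zk) tn.
Qed.

Lemma almost_subset_span z k Z : blocks z k -> module_over D Z ->
  (exists n, forall i, (n <= i)%N -> Z (z i)) -> almost_subset (span_over D z) Z.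
Proof.
move=> zk ZM [n Zz] U [UM UV Un] Uz; split; first exact: module_overI.
  by move=> x [/UV].
move=> m; have [u [Uu u0 tu]] := Un (maxn m (k n)).
exists u; split=> //; last exact: tail_le (leq_maxl _ _) tu.
split=> //; have [p Dp pu] := Uz _ Uu; rewrite -pu.
have p0 : forall i, (i < n)%N -> p`_i = 0.
  by apply: (blocks_coef0 zk); rewrite pu; exact: tail_le (leq_maxr _ _) tu.
rewrite /comb (bigID (fun i : 'I_(size p) => (n <= i)%N)) /=.
rewrite [X in _ + X]big1 ?addr0 => [|i]; last first.
  by rewrite -ltnNge => /p0 ->; rewrite scale0r.
by apply: (module_over_sum _ ZM) => i *; [exact: Dp|exact: Zz].
Qed.

Lemma large_blocks Z : large Z -> exists z k, blocks z k /\ forall n, Z (z n).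
Proof.
move=> Zl; have [||zk [_ zkP]] := @dependent_sequence (X * nat) (fun=> setT)
  (fun _ w w' => [/\ Z w'.1, tail w.2 w'.1, ~ tail w'.2 w'.1 & (w.2 < w'.2)%N]) (0, 0%N).
- by [].
- move=> _ [x n] _; have [u [k uk]] := large_escape n Zl.
  by exists (u, k).
exists (fun n => (zk n.+1).1), (fun n => (zk n).2).
by split=> n; have [_ [Zn tn nt kn]] := zkP n => //; split=> //; case: Zl => _ + _; apply.
Qed.

(** The blocks z n of the fused set are chosen in a decreasing sequence of
    large sets, the n-th of which satisfies Phi n and contains all but finitely
    many of them. *)
Lemma fusion (Phi : nat -> set X -> Prop) Z : large Z ->
  (forall n Y, large Y -> Y `<=` Z ->
     exists Y', [/\ large Y', Y' `<=` Y & Phi n Y']) ->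
  (forall n Y Y', large Y -> large Y' -> almost_subset Y' Y ->
     Phi n Y -> Phi n Y') ->
  exists Y, [/\ large Y, Y `<=` Z & forall n, Phi n Y].
Proof.
move=> Zl dense hered.
pose St := (set X * (X * nat))%type.
have [||w [_ wP]] := @dependent_sequence St (fun _ w => large w.1 /\ w.1 `<=` Z)
  (fun n w w' => [/\ w'.1 `<=` w.1, Phi n w'.1, w'.1 w'.2.1, tail w.2.2 w'.2.1 &
     ~ tail w'.2.2 w'.2.1 /\ (w.2.2 < w'.2.2)%N]) (Z, (0, 0%N)).
- by split=> /=.
- move=> n [Y [x m]] /= [Yl YZ]; have [Y' [Y'l Y'Y PY']] := dense n Y Yl YZ.
  have [u [k [Yu tu nt mk]]] := large_escape m Y'l.
  by exists (Y', (u, k)); split=> //; split=> //; exact: subset_trans Y'Y YZ.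
pose z n := (w n.+1).2.1; pose k n := (w n).2.2.
have wdec m n : (m <= n)%N -> (w n).1 `<=` (w m).1.
  elim: n => [|n IH]; first by rewrite leqn0 => /eqP ->.
  rewrite leq_eqVlt => /orP[/eqP -> //|]; rewrite ltnS => /IH.
  by apply: subset_trans; have [_ []] := wP n.
have zk : blocks z k.
  move=> n; have [_ [_ _ wz tz [nt kn]]] := wP n; split=> //.
  by have [[[_ + _] _] _] := wP n.+1; apply.
exists (span_over D z); split.
- exact: large_span zk.
- apply: span_over_sub; first by case: Zl.
  by move=> n; have [[_ +] _] := wP n.+1; apply; have [_ []] := wP n.
- move=> n; have [[wl _] _] := wP n.+1.
  apply: (hered n (w n.+1).1) => //; first exact: large_span zk.
    apply: (almost_subset_span zk); first by case: wl.
    exists n => i ni; apply: (wdec n.+1 i.+1) => //.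
    by have [_ []] := wP i.
  by have [_ []] := wP n.
Qed.

Definition addset E U : set X := [set x | exists e u, [/\ E e, U u & x = e + u]].
Definition adjoin E x : set X :=
  [set y | exists e d, [/\ E e, D d & y = e + d *: x]].

Definition intertwined E F Z := forall U U', large U -> U `<=` Z ->
  large U' -> U' `<=` Z ->
  exists x y, [/\ addset E U x, addset F U' y & Bad x y].

Definition separated_pair E F Z := forall Z', large Z' -> Z' `<=` Z ->
  ~ intertwined E F Z'.

Lemma intertwined_almost E F Z Z' : almost_subset Z' Z ->
  intertwined E F Z -> intertwined E F Z'.
Proof.
move=> Z'Z EFZ U U' Ul UZ' U'l U'Z'.
have [x [y [[a [b [Ea [Ub _] ->]]] [c [d [Fc [Ud _] ->]]] xy]]] :=
  EFZ _ _ (Z'Z _ Ul UZ') (@subIsetr _ _ _) (Z'Z _ U'l U'Z') (@subIsetr _ _ _).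
by exists (a + b), (c + d); split=> //; [exists a, b|exists c, d].
Qed.

Lemma almost_subset_sub Z Z' : Z `<=` Z' -> almost_subset Z Z'.
Proof.
move=> ZZ' U Ul UZ; suff -> : U `&` Z' = U by [].
by apply/setIidPl; exact: subset_trans ZZ'.
Qed.

Lemma separated_almost E F Z Z' : almost_subset Z' Z ->
  separated_pair E F Z -> separated_pair E F Z'.
Proof.
move=> Z'Z EFZ Y Yl YZ' EFY; apply: (EFZ (Y `&` Z)); first exact: Z'Z.
  exact: subIsetr.
by apply: intertwined_almost EFY; apply: almost_subset_sub; exact: subIsetl.
Qed.

Lemma separated_subset E F Z Z' : Z' `<=` Z ->
  separated_pair E F Z -> separated_pair E F Z'.
Proof. by move=> /almost_subset_sub; exact: separated_almost. Qed.

Lemma separated_sym E F Z : separated_pair E F Z -> separated_pair F E Z.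
Proof.
move=> EFZ Y Yl YZ FEY; apply: (EFZ Y) => // U U' Ul UY U'l U'Y.
have [x [y [Fx Ey xy]]] := FEY _ _ U'l U'Y Ul UY.
by exists y, x; split=> //; exact: Badsym.
Qed.

(** By fusion, a large set decides for every x in V whether the pair obtained by
    adjoining x to E is intertwined. If each of its large subsets contained an x for
    which it is, then adding U to E would absorb x, and
    (E, F) itself would be intertwined. *)
Lemma separated_adjoin E F Z : large Z -> separated_pair E F Z ->
  exists Z', [/\ large Z', Z' `<=` Z &
    forall x, Z' x -> separated_pair (adjoin E x) F Z'].
Proof.
move=> Zl EFZ.
have [n Y Yl YZ|n Y Y' Yl Y'l Y'Y|Y [Yl YZ YP]] := @fusion (fun n Y =>
  intertwined (adjoin E (v n)) F Y \/ separated_pair (adjoin E (v n)) F Y) Z Zl.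
- have [sep|/existsNP[Y' /not_implyP[Y'l /not_implyP[Y'Y /contrapT int]]]] :=
    pselect (separated_pair (adjoin E (v n)) F Y).
    by exists Y; split=> //; right.
  by exists Y'; split=> //; left.
- move=> [int|sep]; [left|right]; first exact: intertwined_almost int.
  exact: separated_almost sep.
apply: contrapT => nZ'; apply: (EFZ Y) => // U U' Ul UY U'l U'Y.
have [x Ux int] : exists2 x, U x & intertwined (adjoin E x) F Y.
  apply: contrapT => nx; apply: nZ'; exists U; split=> //.
    exact: subset_trans UY YZ.
  move=> x Ux; apply: (separated_subset UY).
  have [n nE] : exists n, v n = x by apply: vV; case: Ul => _ + _; apply.
  have := YP n; rewrite nE => -[int|//].
  by case: nx; exists x.
have [_ [y [[_ [u [[e [d [Ee Dd ->]] Uu ->]] Fy xy]]]]] := int U U' Ul UY U'l U'Y.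
exists (e + d *: x + u), y; split=> //; exists e, (d *: x + u).
by rewrite addrA; split=> //; case: Ul => -[_ +] _ _; apply.
Qed.

Lemma separated_adjoin_seq (L : seq (set X * set X)) Z : large Z ->
  (forall q, q \in L -> separated_pair q.1 q.2 Z) ->
  exists Z', [/\ large Z', Z' `<=` Z & forall q x, q \in L -> Z' x ->
    separated_pair (adjoin q.1 x) q.2 Z' /\ separated_pair q.1 (adjoin q.2 x) Z'].
Proof.
elim: L Z => [|q L IH] Z Zl LZ; first by exists Z; split.
have [|Z1 [Z1l Z1Z Z1P]] := IH Z Zl.
  by move=> r rL; apply: LZ; rewrite inE rL orbT.
have qZ : separated_pair q.1 q.2 Z by apply: LZ; rewrite inE eqxx.
have [Z2 [Z2l Z2Z Z2P]] := separated_adjoin Z1l (separated_subset Z1Z qZ).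
have [Z3 [Z3l Z3Z Z3P]] := separated_adjoin Z2l
  (separated_sym (separated_subset Z2Z (separated_subset Z1Z qZ))).
exists Z3; split=> //.
  exact: subset_trans Z3Z (subset_trans Z2Z Z1Z).
move=> r x; rewrite inE => /orP[/eqP ->|rL] Zx.
  split; last by apply: separated_sym; exact: Z3P.
  by apply: (separated_subset Z3Z); apply: Z2P; exact: Z3Z.
have [? ?] := Z1P r x rL (Z2Z _ (Z3Z _ Zx)).
have Z31 : Z3 `<=` Z1 by exact: subset_trans Z3Z Z2Z.
by split; apply: (separated_subset Z31).
Qed.

(** The state is the finite list of all pairs spanned by disjoint parts of the
    vectors chosen so far; each new vector is adjoined to either side of each
    pair. *)
Theorem separated_blocks Z : large Z -> separated_pair [set 0] [set 0] Z ->
  exists x k, [/\ blocks x k, forall n, Z (x n) &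
    forall (c : nat -> K) (a : pred nat) n, (forall i, D (c i)) ->
      ~ Bad (\sum_(i < n | a i) c i *: x i) (\sum_(i < n | ~~ a i) c i *: x i)].
Proof.
move=> Zl Z0.
pose St := (seq (set X * set X) * set X * (X * nat))%type.
have [||w [w0 wP]] := @dependent_sequence St
  (fun _ w => [/\ large w.1.2, w.1.2 `<=` Z &
     forall q, q \in w.1.1 -> separated_pair q.1 q.2 w.1.2])
  (fun _ w w' => [/\ Z w'.2.1, tail w.2.2 w'.2.1, ~ tail w'.2.2 w'.2.1,
     (w.2.2 < w'.2.2)%N & w'.1.1 = [seq (adjoin q.1 w'.2.1, q.2) | q <- w.1.1] ++
       [seq (q.1, adjoin q.2 w'.2.1) | q <- w.1.1]])
  ([:: ([set 0], [set 0])], Z, (0, 0%N)).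
- by split=> // q; rewrite inE => /eqP ->.
- move=> n [[L Y] [x m]] /= [Yl YZ LY].
  have [Y' [Y'l Y'Y Y'P]] := separated_adjoin_seq Yl LY.
  have [u [k [Yu tu nt mk]]] := large_escape m Y'l.
  have Y'Z : Y' `<=` Z by exact: subset_trans Y'Y YZ.
  exists ([seq (adjoin q.1 u, q.2) | q <- L] ++
       [seq (q.1, adjoin q.2 u) | q <- L], Y', (u, k)) => /=.
  split; last by split=> //; exact: Y'Z.
  split=> // r /[!mem_cat] /orP[] /mapP[q qL ->] /=; have [] := Y'P q u qL Yu; by [].
pose x n := (w n.+1).2.1; exists x, (fun n => (w n).2.2).
have Zx n : Z (x n) by have [_ []] := wP n.
split=> //.
  by move=> n; have [_ [_ tz nt kn _]] := wP n; split=> //; case: Zl => _ + _; apply.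
move=> c a n Dc.
have [q [qw q1 q2]] : exists q, [/\ q \in (w n).1.1,
    q.1 (\sum_(i < n | a i) c i *: x i) & q.2 (\sum_(i < n | ~~ a i) c i *: x i)].
  elim: n => [|n [q [qw q1 q2]]].
    exists ([set 0], [set 0]); rewrite w0 !big_ord0; split=> //=.
    by rewrite inE.
  have [_ [_ _ _ _ ->]] := wP n; rewrite -/(x n).
  have sumS (b : pred nat) : \sum_(i < n.+1 | b i) c i *: x i =
      \sum_(i < n | b i) c i *: x i + (if b n then c n *: x n else 0).
    by rewrite big_mkcond big_ord_recr -big_mkcond.
  rewrite (sumS a) (sumS (predC a)) /=.
  case: (a n) => /=; rewrite addr0.
    exists (adjoin q.1 (x n), q.2); split=> //=.
      by rewrite mem_cat map_f.
    by exists (\sum_(i < n | a i) c i *: x i), (c n).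
  exists (q.1, adjoin q.2 (x n)); split=> //=.
    by rewrite mem_cat (map_f (fun q => (q.1, adjoin q.2 (x n)))) ?orbT.
  by exists (\sum_(i < n | ~~ a i) c i *: x i), (c n).
have [[wl _ /(_ q qw) sep] _] := wP n.
move=> bad; apply: (sep _ wl (@subset_refl _ _)) => U U' [[U0 _] _ _] _ [[U'0 _] _ _] _.
do 2 eexists; split; last exact: bad.
  by do 2 eexists; split; [exact: q1|exact: U0|rewrite addr0].
by do 2 eexists; split; [exact: q2|exact: U'0|rewrite addr0].
Qed.

End intertwining.

(** * Scalars *)

Section scalars.
Context {R : realType} {s : scalar_kind}.
Local Notation K := (scalars R s).

(** The field of scalars is R + R I, with I = 0 for real scalars. *)
Lemma scalars_decomposition : exists I : K,
  [/\ ab I <= 1, exists q : rat, I * I = of_real s (ratr q) &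
      forall x, exists r t : R,
        [/\ x = of_real s r + of_real s t * I, `|r| <= ab x & `|t| <= ab x]].
Proof.
case: s.
  exists 0; split; first by rewrite ab0.
    by exists 0; rewrite mul0r raddf0.
  by move=> x; exists x, 0; rewrite mulr0 addr0 normr0 ab_ge0.
exists 'i%C; split.
- by rewrite /ab /to_real /= expr0n expr1n /= add0r sqrtr1.
- exists (-1); rewrite rmorphN rmorph1 /=; apply/eqP; rewrite eq_complex /=.
  by rewrite !(mul0r, mulr0, mulr1, add0r, addr0, sub0r) !eqxx.
- move=> [r t]; exists r, t; split; last 2 first.
  + exact: normr_le_sqrtD.
  + by rewrite /ab /to_real /= addrC; exact: normr_le_sqrtD.
  apply/eqP; rewrite eq_complex /=.
  by rewrite !(mul0r, mulr0, mulr1, add0r, addr0, subr0) !eqxx.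
Qed.

(** The set Q + Q I. *)
Lemma countable_dense_subring : exists d : nat -> K, subring_set (range d) /\
  forall x (e : R), 0 < e -> exists n, ab (x - d n) < e.
Proof.
have [I [I1 [q II] Idec]] := scalars_decomposition.
pose delta (p : rat * rat) : K := of_real s (ratr p.1) + of_real s (ratr p.2) * I.
pose d n := if unpickle n is Some p then delta p else 0.
have dp p : range d (delta p) by exists (pickle p) => //; rewrite /d pickleK.
have delta0 : delta (0, 0) = 0 by rewrite /delta /= !raddf0 of_real0 mul0r addr0.
have dE x : range d x -> exists p, x = delta p.
  move=> [n _ <-]; rewrite /d; case: unpickle => [p|]; first by exists p.
  by exists (0, 0).
exists d; split.
  split.
  - by rewrite -delta0.
  - suff -> : 1 = delta (1, 0) by [].
    by rewrite /delta /= rmorph1 raddf0 of_real0 of_real1 mul0r addr0.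
  - move=> _ _ /dE[p ->] /dE[r ->].
    suff -> : delta p + delta r = delta (p.1 + r.1, p.2 + r.2) by [].
    by rewrite /delta /= !rmorphD !of_realD; ring.
  - move=> _ /dE[p ->]; suff -> : - delta p = delta (- p.1, - p.2) by [].
    by rewrite /delta /= !rmorphN !of_realN; ring.
  - move=> _ _ /dE[p ->] /dE[r ->].
    suff -> : delta p * delta r =
        delta (p.1 * r.1 + p.2 * r.2 * q, p.1 * r.2 + p.2 * r.1) by [].
    have rM (a b : rat) : of_real s (ratr (a * b)) = of_real s (ratr a) * of_real s (ratr b) :> K.
      by rewrite rmorphM of_realM.
    by rewrite /delta /= !rmorphD !of_realD !rM -II; ring.
move=> x e e0; have [r [t [-> _ _]]] := Idec x.
have near_rat (y : R) : exists p : rat, `|y - ratr p| < e / 2.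
  have [|p] := @rat_in_itvoo _ (y - e / 2) y.
    by rewrite ltrBlDr ltrDl divr_gt0.
  rewrite in_itv /= => /andP[p1 p2]; exists p.
  by rewrite gtr0_norm ?subr_gt0// ltrBlDr addrC -ltrBlDr.
have [p rp] := near_rat r; have [p' tp'] := near_rat t.
have [n _ dn] := dp (p, p'); exists n; rewrite dn.
have -> : of_real s r + of_real s t * I - delta (p, p') =
    of_real s (r - ratr p) + of_real s (t - ratr p') * I.
  by rewrite /delta /= !of_realB; ring.
rewrite (le_lt_trans (abD _ _))// abM !ab_of_real.
rewrite [ltRHS](splitr e) ltrD// (le_lt_trans _ tp')//.
by rewrite ler_piMr.
Qed.

End scalars.

(** * Unconditional sequences *)

Lemma geometric_sum_le1 (R : realType) n : \sum_(i < n) (2^-1 : R) ^+ i.+1 <= 1.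
Proof.
suff -> : \sum_(i < n) (2^-1 : R) ^+ i.+1 = 1 - 2^-1 ^+ n.
  by rewrite lerBlDr lerDl exprn_ge0.
elim: n => [|n IH]; first by rewrite big_ord0 expr0 subrr.
by rewrite big_ord_recr IH /= exprS; set u := _ ^+ n; field.
Qed.

Section unconditional.
Context {R : realType} {s : scalar_kind}.
Local Notation K := (scalars R s).
Context {X : normedModType K}.
Implicit Types (A T U Z : set X) (x y : X).

Definition limit_points A : set X :=
  [set x | forall e : R, 0 < e -> exists2 a, A a & nr (x - a) < e].

Lemma sub_limit_points A : A `<=` limit_points A.
Proof. by move=> a Aa e e0; exists a; rewrite // subrr nr0. Qed.

Lemma closed_limit_points A : closed (limit_points A).
Proof.
apply/closedP => x xA e e0; have e2 : 0 < e / 2 by rewrite divr_gt0.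
have [y yA xy] := xA _ e2; have [a Aa ya] := yA _ e2.
exists a => //; rewrite (le_lt_trans (nr_tri y _ _))//.
by rewrite (splitr e) ltrD.
Qed.

Lemma limit_points_linear (D : set K) Z : module_over D Z -> subring_set D ->
  (forall c (e : R), 0 < e -> exists2 d, D d & ab (c - d) < e) ->
  linear_subspace (limit_points Z).
Proof.
move=> ZM DR Ddense; split; first by apply: sub_limit_points; case: ZM.
move=> c x y xZ yZ e e0.
have e3 : 0 < e / 3 by rewrite divr_gt0.
have x1 : 0 < nr x + 1 by rewrite ltr_wpDl ?nr_ge0.
have [d Dd cd] := Ddense c _ (divr_gt0 e3 x1).
have d1 : 0 < ab d + 1 by rewrite ltr_wpDl ?ab_ge0.
have [u Zu xu] := xZ _ (divr_gt0 e3 d1); have [v Zv yv] := yZ _ e3.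
exists (d *: u + v); first by case: ZM => _; apply.
have -> : c *: x + y - (d *: u + v) = (c - d) *: x + (d *: (x - u) + (y - v)).
  by rewrite scalerBl scalerBr opprD !addrA subrK (addrAC (c *: x) y).
rewrite (le_lt_trans (nrD _ _))// (_ : e = e / 3 + (e / 3 + e / 3)); last by field.
rewrite ltrD// ?(le_lt_trans (nrD _ _))// ?ltrD// nrZ.
  rewrite (@le_lt_trans _ _ (ab (c - d) * (nr x + 1)))//.
    by rewrite ler_wpM2l ?ab_ge0// lerDl.
  by rewrite -ltr_pdivlMr.
rewrite (@le_lt_trans _ _ ((ab d + 1) * nr (x - u)))//.
  by rewrite ler_wpM2r ?nr_ge0// lerDl.
by rewrite mulrC -ltr_pdivlMr.
Qed.

Lemma functional_comb (g : nat -> X -> K) (z : nat -> X) p i :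
  (forall n, bounded_functional (g n)) -> (forall n m, g n (z m) = (n == m)%:R) ->
  g i (comb z p) = p`_i.
Proof.
move=> bg gz; rewrite (comb_widen z (n := (size p + i).+1)); last first.
  by rewrite (leq_trans (leq_addr i _)).
rewrite functional_sum//.
have ilt : (i < (size p + i).+1)%N by rewrite ltnS leq_addl.
rewrite (bigD1 (Ordinal ilt)) //= big1 => [|j ji].
  by rewrite addr0 functionalZ// gz eqxx mulr1.
by move: ji; rewrite functionalZ// gz -val_eqE /= eq_sym => /negPf ->; rewrite mulr0.
Qed.

(** The correction removing the first coordinates of an approximation is a
    finite combination, and it is small because these coordinates vanish on
    the limit. *)
Lemma span_approximation (D : set K) (g : nat -> X -> K) (z : nat -> X) t n (e : R) :
  subring_set D -> (forall n, bounded_functional (g n)) ->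
  (forall n m, g n (z m) = (n == m)%:R) ->
  limit_points (span_over D z) t -> (forall i, (i < n)%N -> g i t = 0) -> 0 < e ->
  exists u, [/\ span_over D z u, forall i, (i < n)%N -> g i u = 0 & nr (t - u) < e].
Proof.
move=> DR bg gz tz gt0 e0.
have /choice[M MP] : forall i, exists M : R, 0 < M /\ forall x, ab (g i x) <= M * nr x.
  by move=> i; have [M M0 Mb] := functional_bound (bg i); exists M.
pose B := 1 + \sum_(i < n) M i * nr (z i).
have B0 : 0 < B.
  rewrite ltr_wpDr// sumr_ge0// => i _; rewrite mulr_ge0 ?nr_ge0//.
  by rewrite ltW//; have [] := MP i.
have [v [p Dp pv] tv] := tz _ (divr_gt0 e0 B0).
have Dtake : coefs_in D (p - take_poly n p).
  move=> i; rewrite coefB coef_take_poly; case: ifP => _; first by rewrite subrr; exact: subring_set0.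
  by rewrite subr0.
exists (comb z (p - take_poly n p)); split.
- by exists (p - take_poly n p).
- by move=> i i_n; rewrite functional_comb// coefB coef_take_poly i_n subrr.
have -> : t - comb z (p - take_poly n p) = (t - v) + comb z (take_poly n p).
  have := combP z 1 (p - take_poly n p) (take_poly n p).
  rewrite !scale1r subrK pv => ->.
  by rewrite opprD (addrA t) subrK.
rewrite (le_lt_trans (nrD _ _))//.
(* p`_i is the i-th coordinate of v - t, as that of t is zero *)
apply: (@le_lt_trans _ _ (B * nr (t - v))); last by rewrite mulrC -ltr_pdivlMr.
rewrite mulrDl mul1r lerD2l.
rewrite (comb_widen z (n := n)) ?size_take_poly//.
rewrite (le_trans (nr_sum _ _ _))// mulr_suml ler_sum// => i _.
rewrite coef_take_poly ltn_ord nrZ.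
have -> : p`_i = - g i (t - v).
  by rewrite functionalB// gt0// sub0r opprK -pv functional_comb.
by rewrite abN mulrAC ler_wpM2r ?nr_ge0//; exact: (MP i).2.
Qed.

End unconditional.

Section perturbation.
Context {R : realType} {s : scalar_kind}.
Local Notation K := (scalars R s).

(** Biorthogonal functionals on T bound the coefficients of a combination of
    the t k, so summable perturbations of the t k perturb every combination by
    a small multiple of its norm. *)
Lemma perturbation (X : normedModType K) (D : set K) (V T : set X)
    (f g : nat -> X -> K) (z : nat -> X) (k : nat -> nat) (delta : R) :
  subring_set D -> module_over D V -> (forall n, bounded_functional (f n)) ->
  blocks V f z k -> (forall n, bounded_functional (g n)) ->
  (forall n m, g n (z m) = (n == m)%:R) ->
  linear_subspace T -> infinite_dimensional T ->
  T `<=` limit_points (span_over D z) -> 0 < delta -> delta <= 1 ->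
  exists U, [/\ large D V f U, U `<=` span_over D z &
    forall u, U u -> exists2 t, T t & nr (u - t) <= delta * nr t].
Proof.
move=> DR VM bf zk bg gz TS Tinf Tz d0 d1.
have [t [h [Tt gt bh ht]]] := biorthogonal_system TS Tinf bg.
have /choice[N NP] : forall i, exists N : R, 0 < N /\ forall x, ab (h i x) <= N * nr x.
  by move=> i; have [N N0 Nb] := functional_bound (bh i); exists N.
(* the factor (N n)^-1 compensates the norm of h n *)
pose eta n := delta * 2^-1 ^+ n.+1 / N n.
have eta0 n : 0 < eta n.
  by rewrite divr_gt0 ?(NP n).1// mulr_gt0// exprn_gt0.
have /choice[u uP] : forall n, exists u,
    [/\ span_over D z u, forall i, (i < n)%N -> g i u = 0 & nr (t n - u) < eta n].
  by move=> n; apply: span_approximation => //; [exact: Tz|exact: gt].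
have zV : span_over D z `<=` V.
  by apply: span_over_sub => // i; have [] := zk i.
exists (span_over D u); split.
- split; first exact: span_over_module.
    apply: subset_trans zV; apply: span_over_sub; first exact: span_over_module.
    by move=> i; have [] := uP i.
  move=> n; exists (u n); split; first exact: span_over_gen.
    apply/eqP => un0; have [_ _] := uP n; rewrite un0 subr0 => tn.
    have := (NP n).2 (t n); rewrite ht eqxx ab1; apply/negP; rewrite -ltNge.
    rewrite mulrC -ltr_pdivlMr ?(NP n).1// (lt_le_trans tn)// ler_pM2r.
      rewrite (le_trans _ d1)// ler_piMr//; first exact: ltW.
      by apply: exprn_ile1; rewrite ?invr_ge0// invf_le1// ler1n.
    by rewrite invr_gt0 (NP n).1.
  move=> l ln; have [[p Dp <-] gu _] := uP n.
  rewrite /comb functional_sum// big1// => i _; rewrite functionalZ//.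
  have [i_n|ni] := ltnP i n.
    by rewrite -(functional_comb p i bg gz) gu ?mul0r// -(functional_comb p i bg gz).
  have [_ tz _ _] := zk i; rewrite tz ?mulr0//.
  by rewrite (leq_trans ln)// (leq_trans ni)//; exact: (blocks_ge i zk).
- apply: span_over_sub; first exact: span_over_module.
  by move=> i; have [] := uP i.
move=> _ [p Dp <-]; exists (comb t p).
  by apply: linear_subspace_sum => // i _; apply: linear_subspaceZ.
rewrite /comb -sumrB; under eq_bigr do rewrite -scalerBr.
rewrite (le_trans (nr_sum _ _ _))//.
apply: (@le_trans _ _ (\sum_(i < size p) delta * nr (comb t p) * 2^-1 ^+ i.+1)).
  apply: ler_sum => i _; rewrite nrZ -(functional_comb p i bh ht).
  rewrite (le_trans (ler_pM _ _ ((NP i).2 _) (lexx _))) ?ab_ge0 ?nr_ge0//.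
  have [_ _ /ltW] := uP i; rewrite nrC => ui.
  have c0 : 0 <= N i * nr (comb t p) by rewrite mulr_ge0 ?nr_ge0 ?ltW ?(NP i).1.
  apply: le_trans (ler_wpM2l c0 ui) _; rewrite /eta.
  rewrite le_eqVlt; apply/orP; left; apply/eqP.
  by set c := nr _; set q := _ ^+ _; field; rewrite gt_eqF// (NP i).1.
rewrite -mulr_sumr ler_piMr ?geometric_sum_le1// mulr_ge0 ?nr_ge0// ltW//.
Qed.

Definition close_pair (X : normedModType K) (e : R) (x y : X) :=
  nr (x - y) < e * nr (x + y).

Lemma close_pair_sym (X : normedModType K) e (x y : X) :
  close_pair e x y -> close_pair e y x.
Proof. by rewrite /close_pair (nrC y) (addrC y). Qed.

(** If every large set contained an intertwined one for every e, fusion over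
    the e = 1/n would yield a set Y intertwined for all of them. A projection P onto a
    subspace of the closure of Y and the kernel of P are at a positive angle;
    perturbing both into Y is a contradiction. *)
Lemma subprojective_separated (X : completeNormedModType K) (D : set K)
    (V : set X) (f : nat -> X -> K) :
  subprojective X -> subring_set D ->
  (forall c (e : R), 0 < e -> exists2 d, D d & ab (c - d) < e) ->
  module_over D V -> (forall n, bounded_functional (f n)) ->
  (forall x, V x -> (forall i, f i x = 0) -> x = 0) -> large D V f V ->
  exists (e : R) Z, [/\ 0 < e, large D V f Z &
    separated_pair D V f (@close_pair X e) [set 0] [set 0] Z].
Proof.
move=> subX DR Ddense VM bf Vf Vl; apply: contrapT => nsep.
have flin n := (bf n).1.
have [n Y Yl _|n Y Y' _ _ Y'Y|Y [Yl _ Yint]] := @fusion _ _ D V f DR VM flin Vf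
    (fun n Y => intertwined D V f (@close_pair X n.+1%:R^-1) [set 0] [set 0] Y) V Vl.
- apply: contrapT => nY; apply: nsep; exists n.+1%:R^-1, Y; split=> //.
  by move=> Y' Y'l Y'Y int; apply: nY; exists Y'.
- exact: intertwined_almost.
have [z [k [zk zY]]] := large_blocks Vf Yl.
have /choice[l lP] n : exists l, (l < k n.+1)%N /\ f l (z n) != 0.
  have [_ _ /existsNP[l /not_implyP[lk /eqP fl]] _] := zk n.
  by exists l.
have [|//||g [bg gz]] := @triangular_biorthogonal _ _ X z (fun n => f (l n)).
- by [].
- by move=> n; exact: (lP n).2.
- move=> n m nm; have [_ tz _ _] := zk m; apply: tz.
  exact: leq_trans (lP n).1 (blocks_homo zk nm).
pose Y0 := limit_points (span_over D z).
have Y0S : linear_subspace Y0 by exact: (limit_points_linear (span_over_module z DR) DR Ddense).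
have Y0c : closed Y0 by exact: closed_limit_points.
have Y0z n : Y0 (z n) by apply: sub_limit_points; exact: span_over_gen.
(* P will have its range in Y1, which keeps the vectors
   z n.*2 - P (z n.*2) of its kernel linearly independent *)
pose Y1 := [set y | Y0 y /\ forall n, g n.*2 y = 0].
have Y1S : linear_subspace Y1.
  split; first by split=> [|n]; [exact: Y0S.1|exact: functional0].
  move=> a x y [Y0x gx] [Y0y gy]; split=> [|n]; first exact: Y0S.2.
  by rewrite (bg _).1 gx gy mulr0 addr0.
have Y1c : closed Y1.
  apply/closedP => x xY1; split.
    by apply: (closedP _).1 => // e /xY1[a [Y0a _] xa]; exists a.
  by move=> n; apply: (functional_closed (bg _) _ xY1) => a [].
have Y1inf : infinite_dimensional Y1.
  apply: (@infinite_dimensional_free _ _ Y1 (fun n => z n.*2.+1)).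
    move=> n; split=> // m; rewrite gz; case: eqP => // /(congr1 odd) /=.
    by rewrite !odd_double.
  move=> n c c0 i i_n; have : g i.*2.+1 (\sum_(k < n) c k *: z k.*2.+1) = 0.
    by rewrite c0 functional0.
  rewrite functional_sum// (bigD1 (Ordinal i_n)) //= big1 => [|j ji].
    by rewrite functionalZ// gz eqxx mulr1 addr0.
  rewrite functionalZ// gz eqSS (inj_eq double_inj) eq_sym.
  by move: ji; rewrite -val_eqE /= => /negPf ->; rewrite mulr0.
have [Z ZY1 [_ ZS Zinf [P [Pc PP PZ]]]] := subX Y1 Y1c Y1S Y1inf.
have [M PM] := (continuous_nrP P).1 Pc.
pose p := `|M| + 1.
have p1 : 1 <= p by rewrite lerDr.
have Pp x : nr (P x) <= p * nr x.
  rewrite (le_trans (PM x))// ler_wpM2r ?nr_ge0// (le_trans (ler_norm M))//.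
  by rewrite lerDl.
have ZP x : Z (P x) by rewrite -PZ; exists x.
have PZ1 x : Z x -> P x = x by rewrite -PZ => -[y _ <-]; exact: PP.
pose W := Y0 `&` [set x | P x = 0].
have WS : linear_subspace W.
  split; first by split; [exact: Y0S.1|exact: linear0].
  move=> a x y [Y0x Px] [Y0y Py]; split; first exact: Y0S.2.
  by rewrite /= linearP Px Py scaler0 addr0.
have Winf : infinite_dimensional W.
  apply: (@infinite_dimensional_free _ _ W (fun n => z n.*2 - P (z n.*2))).
    move=> n; split; last by rewrite /= linearB PP subrr.
    exact: (linear_subspaceB Y0S (Y0z _) (ZY1 _ (ZP _)).1).
  move=> n c c0 i i_n; have : g i.*2 (\sum_(k < n) c k *: (z k.*2 - P (z k.*2))) = 0.
    by rewrite c0 functional0.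
  have gP j : g i.*2 (P (z j)) = 0 by have [] := ZY1 _ (ZP (z j)).
  rewrite functional_sum// (bigD1 (Ordinal i_n)) //= big1 => [|j ji].
    by rewrite functionalZ// functionalB// gz gP eqxx subr0 mulr1 addr0.
  rewrite functionalZ// functionalB// gz gP (inj_eq double_inj) eq_sym subr0.
  by move: ji; rewrite -val_eqE /= => /negPf ->; rewrite mulr0.
(* nr t + nr w <= q * nr (t - w) for t in the range and w in the kernel of P;
   perturbations of relative size 1 / (2 q) double this constant at most *)
pose q := 1 + 2 * p.
pose delta : R := (2 * q)^-1.
have d0 : 0 < delta by rewrite invr_gt0 /q; lra.
have d1 : delta <= 1 by rewrite invf_le1 /q; lra.
have [U [Ul Uz UP]] := @perturbation X D V Z f g z k delta DR VM bf zk bg gz ZS Zinf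
  (subset_trans ZY1 (fun x => @proj1 _ _)) d0 d1.
have [U' [U'l U'z U'P]] := @perturbation X D V W f g z k delta DR VM bf zk bg gz WS Winf
  (@subIsetl _ _ _) d0 d1.
have zsY : span_over D z `<=` Y by apply: span_over_sub => //; case: Yl.
have [n nq] : exists n : nat, 4 * q <= n.+1%:R.
  exists (Num.truncn (4 * q)); apply/ltW/truncnS_gt.
have [x [y [[_ [u [-> Uu ->]]] [_ [v [-> U'v ->]]]]]] :=
  Yint n U U' Ul (subset_trans Uz zsY) U'l (subset_trans U'z zsY).
rewrite !add0r /close_pair; apply/negP; rewrite -leNgt ler_pdivrMl ?ltr0n//.
have [t Zt ut] := UP u Uu; have [w [_ Pw] vw] := U'P v U'v.
have tw : nr t <= p * nr (t - w).
  by have := Pp (t - w); rewrite linearB Pw PZ1// subr0.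
have wt : nr w <= (1 + p) * nr (t - w).
  have := nrB t (t - w); rewrite opprB addrC subrK; lra.
have tuvw : nr (t - w) <= nr (u - v) + delta * (nr t + nr w).
  have := nr_tri u t w; have := nr_tri v u w.
  by move: ut vw; rewrite (nrC t u) mulrDr; lra.
have q0 : 0 < q by rewrite /q; lra.
have S2 : nr t + nr w <= 2 * q * nr (u - v).
  have S1 : nr t + nr w <= q * nr (t - w).
    rewrite (_ : q = p + (1 + p)); last by rewrite /q; ring.
    by rewrite mulrDl lerD.
  have : q * nr (t - w) <= q * nr (u - v) + (nr t + nr w) / 2.
    have -> : (nr t + nr w) / 2 = q * (delta * (nr t + nr w)).
      by rewrite /delta; field; rewrite gt_eqF.
    by rewrite -mulrDr ler_pM2l.
  lra.
have uv : nr (u + v) <= 2 * (nr t + nr w).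
  have a := nrD u v; have b := nrD (u - t) t; have c := nrD (v - w) w.
  move: b c; rewrite !subrK => b c.
  have d : delta * nr t <= nr t by rewrite ler_piMl ?nr_ge0.
  have e : delta * nr w <= nr w by rewrite ler_piMl ?nr_ge0.
  lra.
have : 4 * q * nr (u - v) <= n.+1%:R * nr (u - v) by rewrite ler_wpM2r ?nr_ge0.
lra.
Qed.

End perturbation.

Section unconditional_sequence.
Context {R : realType} {s : scalar_kind}.
Local Notation K := (scalars R s).

Lemma zero_functional (X : normedModType K) : bounded_functional (fun _ : X => 0 : K).
Proof.
split=> [a x y|]; first by rewrite mulr0 addr0.
by exists 0 => x; rewrite ab0 mul0r.
Qed.

(** Polynomials with coefficients in the range of d are coded by lists of nat. *)
Lemma span_over_countable (X : lmodType K) (d : nat -> K) (e : nat -> X) :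
  exists v : nat -> X, forall x, span_over (range d) e x -> exists n, v n = x.
Proof.
exists (fun n => if unpickle n is Some l then comb e (Poly (map d l)) else 0).
move=> _ [p Dp <-].
have /choice[c cP] i : exists m, d m = p`_i by have [m _ <-] := Dp i; exists m.
exists (pickle (mkseq c (size p))); rewrite pickleK; congr (comb e _).
apply/polyP => i; rewrite coef_Poly -map_comp.
have [ip|pi] := ltnP i (size p).
  by rewrite (nth_map 0%N) ?size_iota//= nth_iota// add0n cP.
by rewrite !nth_default// size_map size_iota.
Qed.

(** Two combinations of disjoint parts of the sequence are the half sum and
    the half difference of a combination and of the one with opposite signs on
    one part, so that the absence of close pairs bounds each part. *)
Lemma subset_bound_dense (X : normedModType K) (D : set K) (x : nat -> X) (e : R) :
  subring_set D -> 0 < e ->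
  (forall (c : nat -> K) (a : pred nat) n, (forall i, D (c i)) ->
    ~ close_pair e (\sum_(i < n | a i) c i *: x i) (\sum_(i < n | ~~ a i) c i *: x i)) ->
  forall (c : nat -> K) (a : pred nat) n, (forall i, D (c i)) ->
    nr (\sum_(i < n | a i) c i *: x i) <= (1 + e^-1) * nr (\sum_(i < n) c i *: x i).
Proof.
move=> DR e0 nclose c a n Dc.
pose c' i := if a i then c i else - c i.
have Dc' i : D (c' i) by rewrite /c'; case: ifP => // _; exact: subring_setN.
have := nclose c' a n Dc'.
have -> : \sum_(i < n | a i) c' i *: x i = \sum_(i < n | a i) c i *: x i.
  by apply: eq_bigr => i ai; rewrite /c' ai.
have -> : \sum_(i < n | ~~ a i) c' i *: x i = - \sum_(i < n | ~~ a i) c i *: x i.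
  by rewrite -sumrN; apply: eq_bigr => i /negPf ai; rewrite /c' ai scaleNr.
have -> : \sum_(i < n) c i *: x i =
    \sum_(i < n | a i) c i *: x i + \sum_(i < n | ~~ a i) c i *: x i.
  by rewrite (bigID (fun i : 'I_n => a i)).
rewrite /close_pair opprK.
set u := \sum_(i < n | a i) _; set v := \sum_(i < n | ~~ a i) _.
move=> /negP; rewrite -leNgt => uv.
have uv' : nr (u - v) <= e^-1 * nr (u + v) by rewrite ler_pdivlMl.
have := nrD (u + v) (u - v); rewrite addrACA subrr addr0 -mulr2n -scaler_nat nrZ.
have -> : (2%:R : K) = of_real s 2%:R by rewrite !mulr2n of_realD of_real1.
rewrite ab_of_real ger0_norm// mulrDl mul1r.
have := nr_ge0 u; have := nr_ge0 (u + v); have := nr_ge0 (u - v); lra.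
Qed.

(** Both sides are continuous in the coefficients. *)
Lemma subset_bound_all (X : normedModType K) (D : set K) (x : nat -> X) (C : R) :
  (forall c (e : R), 0 < e -> exists2 d, D d & ab (c - d) < e) -> 0 <= C ->
  (forall (c : nat -> K) (a : pred nat) n, (forall i, D (c i)) ->
    nr (\sum_(i < n | a i) c i *: x i) <= C * nr (\sum_(i < n) c i *: x i)) ->
  forall (c : nat -> K) (a : pred nat) n,
    nr (\sum_(i < n | a i) c i *: x i) <= C * nr (\sum_(i < n) c i *: x i).
Proof.
move=> Ddense C0 Dbound c a n.
pose B := (C + 1) * (1 + \sum_(i < n) nr (x i)).
have B0 : 0 < B.
  apply: mulr_gt0; first by rewrite ltr_wpDl.
  by rewrite ltr_wpDr// sumr_ge0// => i _; exact: nr_ge0.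
apply/ler_addgt0Pr => e e0.
have /choice[d dP] i : exists d, D d /\ ab (c i - d) < e / B.
  by have [d Dd cd] := Ddense (c i) _ (divr_gt0 e0 B0); exists d.
have near (b : pred nat) :
    nr (\sum_(i < n | b i) c i *: x i - \sum_(i < n | b i) d i *: x i) <=
    e / B * (1 + \sum_(i < n) nr (x i)).
  rewrite -sumrB; under eq_bigr do rewrite -scalerBl.
  rewrite (le_trans (nr_sum _ _ _))// mulrDr mulr1 mulr_sumr.
  apply: ler_wpDl; first by rewrite ltW// divr_gt0.
  rewrite big_mkcond /=; apply: ler_sum => i _; case: (b i).
    by rewrite nrZ ler_wpM2r ?nr_ge0// ltW// (dP i).2.
  by rewrite mulr_ge0 ?nr_ge0// ltW// divr_gt0.
have n1 := near a; have n2 := near xpredT.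
have n3 := Dbound d a n (fun i => (dP i).1).
set u := \sum_(i < n | a i) c i *: x i in n1 *.
set u' := \sum_(i < n | a i) d i *: x i in n1 n3.
set v := \sum_(i < n) c i *: x i in n2 *.
set v' := \sum_(i < n) d i *: x i in n2 n3.
have uu' := nr_tri u' u 0; have vv' := nr_tri v v' 0.
rewrite !subr0 in uu' vv'; rewrite nrC in vv'.
have := ler_wpM2l C0 (le_trans vv' (lerD n2 (lexx (nr v)))).
rewrite mulrDr.
suff : C * (e / B * (1 + \sum_(i < n) nr (x i))) +
  e / B * (1 + \sum_(i < n) nr (x i)) = e by lra.
rewrite /B; set t := 1 + _.
have t0 : t != 0 by rewrite gt_eqF// ltr_wpDr// sumr_ge0// => i _; exact: nr_ge0.
by field; rewrite t0 gt_eqF// ltr_wpDl.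
Qed.

Theorem subprojective_unconditional_sequence (X : completeNormedModType K) :
  infinite_dimensional [set: X] -> subprojective X ->
  exists (x : nat -> X) (g : nat -> X -> K) (C : R),
    [/\ forall n, bounded_functional (g n),
        forall n m, g n (x m) = (n == m)%:R, 1 <= C &
        forall (c : nat -> K) (a : pred nat) n,
          nr (\sum_(i < n | a i) c i *: x i) <= C * nr (\sum_(i < n) c i *: x i)].
Proof.
move=> Xinf subX.
have [||e [f [_ _ bf fe]]] := @biorthogonal_system _ _ X setT (fun _ _ => 0) _ Xinf.
- by [].
- by move=> n; exact: zero_functional.
have [d [DR Dd]] := @countable_dense_subring R s.
pose D := range d; pose V := span_over D e.
have Ddense c (eps : R) : 0 < eps -> exists2 d, D d & ab (c - d) < eps.
  by move=> /(Dd c)[n cn]; exists (d n) => //; exists n.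
have VM : module_over D V by exact: span_over_module.
have flin n := (bf n).1.
have Vf x : V x -> (forall i, f i x = 0) -> x = 0.
  move=> [p Dp <-] fp0; have -> : p = 0; last exact: comb0.
  by apply/polyP => i; rewrite coef0 -(functional_comb p i bf fe).
have eb : blocks V f e id.
  move=> n; split=> //; first exact: span_over_gen.
    by move=> i i_n; rewrite fe ltn_eqF.
  by move=> /(_ n (ltnSn n)) /eqP; rewrite fe eqxx oner_eq0.
have Vl : large D V f V := large_span DR VM flin eb.
have [eps [Z [eps0 Zl Zsep]]] := subprojective_separated subX DR Ddense VM bf Vf Vl.
have [v vV] := span_over_countable d e.
have [x [k [xk _ xP]]] := separated_blocks DR VM flin Vf vV (@close_pair_sym _ _ X eps) Zl Zsep.
have /choice[l lP] n : exists l, (l < k n.+1)%N /\ f l (x n) != 0.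
  have [_ _ /existsNP[l /not_implyP[lk /eqP fl]] _] := xk n.
  by exists l.
have [|||g [bg gx]] := @triangular_biorthogonal _ _ X x (fun n => f (l n)).
- by [].
- by move=> n; exact: (lP n).2.
- move=> n m nm; have [_ tx _ _] := xk m; apply: tx.
  exact: leq_trans (lP n).1 (blocks_homo xk nm).
have eps1 : 0 < eps^-1 by rewrite invr_gt0.
exists x, g, (1 + eps^-1); split=> //; first by rewrite lerDl ltW.
apply: (subset_bound_all Ddense); first by rewrite addr_ge0// ltW.
exact: subset_bound_dense.
Qed.

End unconditional_sequence.

(** * Rank one operators *)

Section rank_one.
Context {R : realType} {s : scalar_kind}.
Local Notation K := (scalars R s).

Lemma bounded_operator_of (X Y : normedModType K) (f : X -> Y) (M : R) :
  linear f -> (forall x, nr (f x) <= M * nr x) ->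
  exists T : bounded_operator X Y, forall x, T x = f x.
Proof.
move=> flin fM.
have fP : f \in @bounded_linear_pred _ X Y.
  apply/asboolP; split=> //; exists (of_real s M) => x.
  by rewrite -!nrE -of_realM ler_of_real.
by exists (BoundedOperator fP).
Qed.

Lemma bounded_operator_ext (X Y : normedModType K) (S T : bounded_operator X Y) :
  (forall x, S x = T x) -> S = T.
Proof. by move=> ST; apply/val_inj/funext. Qed.

Lemma nr_operator (X Y : normedModType K) (T : bounded_operator X Y) x :
  nr (T x) <= nr T * nr x.
Proof.
have := operator_norm_bound T x; rewrite -operator_normE -!nrE -of_realM.
by rewrite ler_of_real.
Qed.

Lemma nr_operator_le (X Y : normedModType K) (T : bounded_operator X Y) (M : R) :
  0 <= M -> (forall x, nr (T x) <= M * nr x) -> nr T <= M.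
Proof.
move=> M0 TM; rewrite -(@ler_of_real R s) nrE operator_normE.
apply: operator_norm_le => x; rewrite -nrE -(@of_real1 R s) ler_of_real => x1.
by rewrite -nrE ler_of_real (le_trans (TM x))// ler_piMr.
Qed.

(** X embeds in its operators as f(.) x for a fixed functional f, and the
    evaluation at a vector where f takes the value 1 retracts this embedding. *)
Lemma subprojective_operators (X : completeNormedModType K) :
  infinite_dimensional [set: X] -> subprojective (bounded_operator X X) ->
  subprojective X.
Proof.
move=> Xinf subB Y Yc YS Yinf.
have [|x0 _ x00] := infinite_dimensional_nonzero _ Xinf; first by [].
have [f0 bf0 f0x] := separating_functional x00.
pose e := (f0 x0)^-1 *: x0.
have fe : f0 e = 1 by rewrite functionalZ// mulVf.
have [M M0 fM] := functional_bound bf0.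
have /choice[T TE] x : exists T : bounded_operator X X, forall y, T y = f0 y *: x.
  apply: (@bounded_operator_of _ _ _ (M * nr x)) => [a y z|y].
    by rewrite bf0.1 scalerDl scalerA.
  by rewrite nrZ mulrAC ler_wpM2r ?nr_ge0.
have Tlin a x y : T (a *: x + y) = a *: T x + T y.
  apply: bounded_operator_ext => z; rewrite TE bounded_operatorD bounded_operatorZ.
  by rewrite !TE scalerDr !scalerA mulrC.
have TB x y : T (x - y) = T x - T y.
  by rewrite addrC -scaleN1r Tlin scaleN1r addrC.
have T0 : T 0 = 0 by have := TB 0 0; rewrite !subrr.
have Te x : T x e = x by rewrite TE fe scale1r.
have Tb x : nr (T x) <= M * nr x.
  apply: nr_operator_le => [|y]; first by rewrite mulr_ge0 ?nr_ge0// ltW.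
  by rewrite TE nrZ mulrAC ler_wpM2r ?nr_ge0.
have evb (S : bounded_operator X X) : nr (S e) <= nr e * nr S.
  by rewrite mulrC nr_operator.
pose TY := [set S : bounded_operator X X | exists2 y, Y y & S = T y].
have TYc : closed TY.
  apply/closedP => S SY; exists (S e).
    apply: ((closedP Y).1 Yc) => eps eps0.
    have e1 : 0 < nr e + 1 by rewrite ltr_wpDl ?nr_ge0.
    have [_ [y Yy ->] Sy] := SY _ (divr_gt0 eps0 e1); exists y => //.
    rewrite -{1}(Te y) -bounded_operatorB (le_lt_trans (evb _))//.
    rewrite (@le_lt_trans _ _ ((nr e + 1) * nr (S - T y)))//.
      by rewrite ler_wpM2r ?nr_ge0// lerDl.
    by rewrite mulrC -ltr_pdivlMr.
  apply/eqP; rewrite -subr_eq0; apply/eqP/nr_le_eq0 => eps eps0.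
  have e1 : 0 < 1 + M * nr e by rewrite ltr_wpDr// mulr_ge0 ?nr_ge0// ltW.
  have [_ [y Yy ->] Sy] := SY _ (divr_gt0 eps0 e1).
  rewrite (le_trans (nr_tri (T y) _ _))//.
  rewrite (@le_trans _ _ ((1 + M * nr e) * nr (S - T y)))//.
    rewrite mulrDl mul1r lerD2l -TB (le_trans (Tb _))// -mulrA ler_wpM2l//.
      exact: ltW.
    by rewrite nrC -{1}(Te y) -bounded_operatorB evb.
  by rewrite mulrC -ler_pdivlMr// ltW.
have TYS : linear_subspace TY.
  split.
    by exists 0; rewrite ?T0//; exact: YS.1.
  move=> a _ _ [x Yx ->] [y Yy ->]; exists (a *: x + y); first exact: YS.2.
  by rewrite Tlin.
have Tsum n (c : 'I_n -> K) (u : 'I_n -> X) :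
    T (\sum_i c i *: u i) = \sum_i c i *: T (u i).
  by elim/big_rec2: _ => // i x y _ <-; rewrite Tlin.
have TYinf : infinite_dimensional TY.
  move=> [n [v TYv]]; apply: Yinf; exists n, (fun i => v i e).
  have sume (c : 'I_n -> K) : (\sum_i c i *: v i) e = \sum_i c i *: v i e.
    elim/big_rec2: _ => // i x y _ <-.
    by rewrite bounded_operatorD bounded_operatorZ.
  apply/seteqP; split=> [y Yy|_ [c _ <-]].
    have : TY (T y) by exists y.
    by rewrite TYv => -[c _ cE]; exists c => //; rewrite -sume cE Te.
  have : TY (\sum_i c i *: v i) by rewrite TYv; exists c.
  by move=> [y Yy yE]; rewrite -sume yE Te.
have [Z ZTY [Zc ZS Zinf [P [Pc PP PZ]]]] := subB TY TYc TYS TYinf.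
have ZT S : Z S -> S = T (S e) by move=> /ZTY[y _ ->]; rewrite Te.
have [N PN] := (continuous_nrP P).1 Pc.
have N0 : 0 <= `|N| by [].
have Qlin : linear (fun x => (P (T x)) e).
  by move=> a x y; rewrite Tlin linearP.
pose Q := GRing.isLinear.Build K X X *:%R _ Qlin.
pose Q' : {linear X -> X} := HB.pack (fun x => (P (T x)) e) Q.
have Qb x : nr (Q' x) <= nr e * (`|N| * M) * nr x.
  rewrite -!mulrA (le_trans (evb _))// ler_wpM2l ?nr_ge0//.
  rewrite (le_trans (PN _))// (@le_trans _ _ (`|N| * nr (T x)))//.
    by rewrite ler_wpM2r ?nr_ge0// ler_norm.
  by rewrite ler_wpM2l.
have ZP S : Z (P S) by rewrite -PZ; exists S.
exists [set x | Z (T x)].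
  by move=> x /ZTY[y Yy /(congr1 (fun S : bounded_operator X X => S e))]; rewrite !Te => ->.
split.
- apply/closedP => x xZ; apply: ((closedP Z).1 Zc) => eps eps0.
  have [y Zy xy] := xZ _ (divr_gt0 eps0 M0); exists (T y) => //.
  by rewrite -TB (le_lt_trans (Tb _))// mulrC -ltr_pdivlMr.
- split; first by rewrite /= T0; exact: ZS.1.
  by move=> a x y Zx Zy; rewrite /= Tlin; exact: ZS.2.
- move=> [n [v Zv]]; apply: Zinf; exists n, (fun i => T (v i)).
  apply/seteqP; split=> [S ZS'|_ [c _ <-]].
    have : [set x | Z (T x)] (S e) by rewrite /= -ZT.
    by rewrite Zv => -[c _ cE]; exists c => //; rewrite -Tsum cE -ZT.
  have : [set x | Z (T x)] (\sum_i c i *: v i) by rewrite Zv; exists c.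
  by rewrite /= Tsum.
- exists Q'; split.
  + by apply/continuous_nrP; exists (nr e * (`|N| * M)).
  + by move=> x; rewrite /= -ZT// PP.
  + apply/seteqP; split=> [_ [x _ <-]|x Zx] /=; first by rewrite -ZT.
    exists x => //=; have : Z (T x) by [].
    by rewrite -PZ => -[S _ SE]; rewrite -SE PP SE Te.
Qed.

End rank_one.

(** * Bounded sequences of multipliers *)

Section multipliers.
Context {R : realType} {s : scalar_kind}.
Local Notation K := (scalars R s).

(** The norm is convex in each coefficient, so on a cube it is largest at a
    vertex. *)
Lemma unit_multiplier_bound (X : normedModType K) n (y : nat -> X) (M : R) (w : X) :
  (forall b : pred nat, nr (w + \sum_(i < n | b i) y i) <= M) ->
  forall a : nat -> R, (forall i, 0 <= a i <= 1) ->
    nr (w + \sum_(i < n) of_real s (a i) *: y i) <= M.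
Proof.
elim: n w => [|n IH] w wM a a01.
  by have := wM xpredT; rewrite !big_ord0.
have step (b : pred nat) : \sum_(i < n.+1 | b i) y i =
    \sum_(i < n | b i) y i + (if b n then y n else 0).
  by rewrite big_mkcond big_ord_recr -big_mkcond.
have h0 : nr (w + \sum_(i < n) of_real s (a i) *: y i) <= M.
  apply: IH => // b; pose b' : pred nat := fun i => b i && (i < n)%N.
  have := wM b'; rewrite (step b') /b' ltnn andbF addr0.
  by under eq_bigl => i do rewrite ltn_ord andbT.
have h1 : nr (w + y n + \sum_(i < n) of_real s (a i) *: y i) <= M.
  apply: IH => // b; pose b' : pred nat := fun i => b i && (i < n)%N || (i == n).
  have := wM b'; rewrite (step b') /b' eqxx orbT -addrA [_ + y n]addrC.
  by under eq_bigl => i do rewrite ltn_ord andbT (ltn_eqF (ltn_ord i)) orbF.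
rewrite big_ord_recr /=; set u := \sum_(i < n) _ in h0 h1 *.
have /andP[an0 an1] := a01 n.
have -> : w + (u + of_real s (a n) *: y n) =
    of_real s (1 - a n) *: (w + u) + of_real s (a n) *: (w + y n + u).
  rewrite [w + y n + u]addrAC (scalerDr _ (w + u)) [RHS]addrA -scalerDl.
  by rewrite -of_realD subrK of_real1 scale1r addrA.
rewrite (le_trans (nrD _ _))// !nrZ !ab_of_real !ger0_norm ?subr_ge0//.
have := ler_wpM2l an0 h1; have an1' : 0 <= 1 - a n by rewrite subr_ge0.
have := ler_wpM2l an1' h0; lra.
Qed.

(** A scalar is a combination of four nonnegative reals: the positive and
    negative parts of its two coordinates. *)
Lemma multiplier_bound (X : normedModType K) n (y : nat -> X) (B M : R) :
  (forall b : pred nat, nr (\sum_(i < n | b i) y i) <= B) -> 0 < M ->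
  forall a : nat -> K, (forall i, ab (a i) <= M) ->
    nr (\sum_(i < n) a i *: y i) <= 4 * B * M.
Proof.
move=> yB M0 a aM; have [I [I1 _ Idec]] := @scalars_decomposition R s.
have /choice[r /choice[t rt]] i := Idec (a i).
have rM i : `|r i| <= M by have [_ ri _] := rt i; rewrite (le_trans ri).
have tM i : `|t i| <= M by have [_ _ ti] := rt i; rewrite (le_trans ti).
have pos (u : nat -> R) : (forall i, 0 <= u i <= M) ->
    nr (\sum_(i < n) of_real s (u i) *: y i) <= M * B.
  move=> uM; have -> : \sum_(i < n) of_real s (u i) *: y i =
      of_real s M *: (0 + \sum_(i < n) of_real s (u i / M) *: y i).
    rewrite add0r scaler_sumr; apply: eq_bigr => i _.
    by rewrite scalerA -of_realM mulrC divfK// gt_eqF.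
  rewrite nrZ ab_of_real gtr0_norm// ler_pM2l//.
  apply: (@unit_multiplier_bound X n y B 0 _ (fun i => u i / M)) => [b|i].
    by rewrite add0r.
  have /andP[u0 u1] := uM i; apply/andP; split.
    by rewrite divr_ge0// ltW.
  by rewrite ler_pdivrMr// mul1r.
have signed (u : nat -> R) : (forall i, `|u i| <= M) ->
    nr (\sum_(i < n) of_real s (u i) *: y i) <= 2 * (M * B).
  move=> uM; have -> : \sum_(i < n) of_real s (u i) *: y i =
      \sum_(i < n) of_real s (Num.max (u i) 0) *: y i -
      \sum_(i < n) of_real s (Num.max (- u i) 0) *: y i.
    rewrite -sumrB; apply: eq_bigr => i _; rewrite -scalerBl -of_realB.
    congr (of_real s _ *: _); rewrite /Num.max.
    by case: ifPn; case: ifPn; rewrite -?leNgt; lra.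
  have p1 := pos (fun i => Num.max (u i) 0); have p2 := pos (fun i => Num.max (- u i) 0).
  rewrite (le_trans (nrB _ _))// mulrDl mul1r lerD//; [apply: p1|apply: p2] => i.
    by have := uM i; rewrite ler_norml le_max lexx orbT ge_max => /andP[_ ->]; rewrite ltW.
  by have := uM i; rewrite ler_norml le_max lexx orbT ge_max lerNl => /andP[-> _]; rewrite ltW.
have -> : \sum_(i < n) a i *: y i = \sum_(i < n) of_real s (r i) *: y i +
    I *: \sum_(i < n) of_real s (t i) *: y i.
  rewrite scaler_sumr -big_split; apply: eq_bigr => i _ /=.
  by have [-> _ _] := rt i; rewrite scalerDl scalerA [I * _]mulrC.
rewrite (le_trans (nrD _ _))// nrZ.
have s1 := signed r rM; have s2 := signed t tM.
have : ab I * nr (\sum_(i < n) of_real s (t i) *: y i) <=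
    nr (\sum_(i < n) of_real s (t i) *: y i) by rewrite ler_piMl ?nr_ge0.
move: s1 s2; rewrite [M * B]mulrC; set q := B * M.
have -> : 4 * B * M = 4 * q by rewrite /q mulrA.
lra.
Qed.

Definition bounded_seq (a : nat -> K) := exists M : R, forall n, ab (a n) <= M.

(** Bounded sequences form a subset of the functions on nat, and S is constrained
    on this subset only. *)
Record linf_embedding (E : normedModType K) (S : (nat -> K) -> E) (c C : R) : Prop :=
  LinfEmbedding {
    linf_embedding_linear : forall t a b, bounded_seq a -> bounded_seq b ->
      S (fun n => t * a n + b n) = t *: S a + S b ;
    linf_embedding_gt0 : 0 < c ;
    linf_embedding_upper : forall a M, 0 < M -> (forall n, ab (a n) <= M) ->
      nr (S a) <= C * M ;
    linf_embedding_lower : forall a n, bounded_seq a -> c * ab (a n) <= nr (S a) }.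

End multipliers.

Section unconditional_space.
Context {R : realType} {s : scalar_kind}.
Local Notation K := (scalars R s).
Context {X : completeNormedModType K}.
Context (x : nat -> X) (g : nat -> X -> K) (C : R).
Context (bg : forall n, bounded_functional (g n)).
Context (gx : forall n m, g n (x m) = (n == m)%:R).
Context (C1 : 1 <= C).
Context (Cx : forall (c : nat -> K) (a : pred nat) n,
  nr (\sum_(i < n | a i) c i *: x i) <= C * nr (\sum_(i < n) c i *: x i)).

Let C0 : 0 < C. Proof. exact: lt_le_trans C1. Qed.

Definition closed_span : set X := limit_points (span_over setT x).

Let setT_subring : subring_set [set: K]. Proof. by []. Qed.

Let setT_dense (c : K) (e : R) : 0 < e -> exists2 d, [set: K] d & ab (c - d) < e.
Proof. by exists c => //; rewrite subrr ab0. Qed.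

Lemma closed_span_linear : linear_subspace closed_span.
Proof.
exact: (limit_points_linear (span_over_module x setT_subring) setT_subring setT_dense).
Qed.

Lemma closed_span_gen n : closed_span (x n).
Proof. by apply: sub_limit_points; exact: span_over_gen. Qed.

Lemma closed_span_infinite : infinite_dimensional closed_span.
Proof.
apply: (@infinite_dimensional_free _ _ _ x); first exact: closed_span_gen.
move=> n c c0 i i_n; have := functional_comb (\poly_(i < n) c i) i bg gx.
by rewrite comb_poly c0 functional0// coef_poly i_n.
Qed.

Definition expansion (a : nat -> K) n (y : X) := \sum_(i < n) (a i * g i y) *: x i.

Let partial n y := \sum_(i < n) g i y *: x i.

Let partialB n y z : partial n (y - z) = partial n y - partial n z.
Proof.
by rewrite /partial -sumrB; apply: eq_bigr => i _; rewrite functionalB// scalerBl.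
Qed.

Let subset_bound (b : pred nat) n y : closed_span y ->
  nr (\sum_(i < n | b i) g i y *: x i) <= C * nr y.
Proof.
move=> yW; apply/ler_addgt0Pr => e e0.
have /choice[M MP] i : exists M : R, 0 < M /\ forall y, ab (g i y) <= M * nr y.
  by have [M M0 Mb] := functional_bound (bg i); exists M.
pose B := C + \sum_(i < n) M i * nr (x i).
have S0 : 0 <= \sum_(i < n) M i * nr (x i).
  by rewrite sumr_ge0// => i _; rewrite mulr_ge0 ?nr_ge0// ltW// (MP i).1.
have B0 : 0 < B by rewrite ltr_wpDr.
have [v [p _ pv] yv] := yW _ (divr_gt0 e0 B0).
have vC : nr (\sum_(i < n | b i) g i v *: x i) <= C * nr v.
  have -> : \sum_(i < n | b i) g i v *: x i =
      \sum_(i < maxn n (size p) | b i && (i < n)%N) p`_i *: x i.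
    rewrite (big_ord_widen_cond (maxn n (size p)) b (fun i => g i v *: x i)) ?leq_maxl//.
    by apply: eq_bigr => i _; rewrite -pv functional_comb.
  rewrite (le_trans (Cx (fun i => p`_i) (fun i => b i && (i < n)%N) _))//.
  by rewrite -pv (comb_widen x (leq_maxr n (size p))).
have yvB : nr (\sum_(i < n | b i) g i (y - v) *: x i) <=
    (\sum_(i < n) M i * nr (x i)) * nr (y - v).
  rewrite (le_trans (nr_sum _ _ _))// mulr_suml big_mkcond; apply: ler_sum => i _.
  case: (b i); first by rewrite nrZ mulrAC ler_wpM2r ?nr_ge0// (MP i).2.
  by rewrite !mulr_ge0 ?nr_ge0// ltW// (MP i).1.
have -> : \sum_(i < n | b i) g i y *: x i =
    \sum_(i < n | b i) g i v *: x i + \sum_(i < n | b i) g i (y - v) *: x i.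
  rewrite -big_split; apply: eq_bigr => i _ /=.
  by rewrite functionalB// -scalerDl addrC subrK.
rewrite (le_trans (nrD _ _))//.
have vy : nr v <= nr y + nr (y - v).
  by have := nrB y (y - v); rewrite opprB addrC subrK.
have := ler_wpM2l (ltW C0) vy; rewrite mulrDr.
have : B * nr (y - v) <= e by rewrite mulrC -ler_pdivlMr// ltW.
rewrite /B mulrDl; lra.
Qed.

Let partial_closed_span n y : closed_span (partial n y).
Proof.
apply: (linear_subspace_sum _ closed_span_linear) => i _.
exact: (linear_subspaceZ _ closed_span_linear (closed_span_gen i)).
Qed.

Lemma partial_cvg y : closed_span y -> forall e : R, 0 < e ->
  exists N, forall n, (N <= n)%N -> nr (y - partial n y) < e.
Proof.
move=> yW e e0; have C10 : 0 < 1 + C by rewrite ltr_wpDl.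
have [v [p _ pv] yv] := yW _ (divr_gt0 e0 C10).
exists (size p) => n pn; have vn : partial n v = v.
  rewrite -pv (comb_widen x pn); apply: eq_bigr => i _.
  by rewrite -(comb_widen x pn) functional_comb.
have -> : y - partial n y = (y - v) - partial n (y - v).
  by rewrite partialB vn opprB addrA subrK.
have yvW : closed_span (y - v).
  apply: (linear_subspaceB closed_span_linear) => //.
  by apply: sub_limit_points; exists p.
rewrite (le_lt_trans (nrB _ _))// (@le_lt_trans _ _ ((1 + C) * nr (y - v)))//.
  by rewrite mulrDl mul1r lerD2l; exact: (subset_bound xpredT).
by rewrite mulrC -ltr_pdivlMr.
Qed.

Lemma expansion_bound a n y (M : R) : closed_span y -> 0 < M ->
  (forall i, ab (a i) <= M) -> nr (expansion a n y) <= 4 * C * M * nr y.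
Proof.
move=> yW M0 aM.
have := @multiplier_bound R s X n (fun i => g i y *: x i) (C * nr y) M
  (fun b => subset_bound b n yW) M0 a aM.
under eq_bigr do rewrite scalerA.
move=> /le_trans; apply.
by rewrite !mulrA -mulrA [nr y * M]mulrC mulrA.
Qed.

(** The tail of the expansion of y is an expansion of y minus a partial sum. *)
Lemma expansion_cvg a y : bounded_seq a -> closed_span y -> exists l : X,
  forall e : R, 0 < e -> exists N, forall n, (N <= n)%N -> nr (expansion a n y - l) < e.
Proof.
move=> [M aM] yW; apply: nr_complete => e e0.
pose M' := `|M| + 1; have M0 : 0 < M' by rewrite ltr_wpDl.
have aM' i : ab (a i) <= M'.
  by rewrite (le_trans (aM i))// (le_trans (ler_norm M))// lerDl.
have Q0 : 0 < 4 * C * M' by rewrite !mulr_gt0.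
have [N yN] := partial_cvg yW (divr_gt0 e0 Q0).
have tailb m n : (N <= m)%N -> (m <= n)%N ->
    nr (expansion a n y - expansion a m y) < e.
  move=> Nm mn; pose w := y - partial m y.
  have wW : closed_span w.
    exact: (linear_subspaceB closed_span_linear yW (partial_closed_span _ _)).
  have -> : expansion a n y - expansion a m y = expansion a n w.
    rewrite /expansion (big_ord_widen n (fun i => (a i * g i y) *: x i) mn).
    rewrite [X in _ - X]big_mkcond -sumrB; apply: eq_bigr => i _.
    have -> : g i w = g i y - (if (i < m)%N then g i y else 0).
      rewrite functionalB//; congr (_ - _).
      have := functional_comb (\poly_(j < m) g j y) i bg gx.
      by rewrite comb_poly coef_poly.
    by case: ifP => _; rewrite ?subr0// !subrr mulr0 scale0r.
  rewrite (le_lt_trans (expansion_bound n wW M0 aM'))// mulrC -ltr_pdivlMr//.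
  exact: yN.
exists N => m n Nm Nn; have [mn|/ltnW nm] := leqP m n; last exact: tailb.
by rewrite nrC; exact: tailb.
Qed.

(** Blocks carried by vectors of a complemented subspace Z of the closed span:
    multiplying the k-th block by a k defines, after projecting onto Z, an
    operator whose norm is equivalent to the supremum of the a k. *)
Lemma linf_operators : subprojective X ->
  exists (S : (nat -> K) -> bounded_operator X X) (c c' : R), linf_embedding S c c'.
Proof.
move=> subX.
have [Z ZW [_ ZS Zinf [P [Pc PP PZ]]]] :=
  subX _ (@closed_limit_points _ _ _ _) closed_span_linear closed_span_infinite.
have [L PL] := (continuous_nrP P).1 Pc.
pose p := `|L| + 1.
have p0 : 0 < p by rewrite ltr_wpDl.
have Pp y : nr (P y) <= p * nr y.
  rewrite (le_trans (PL y))// ler_wpM2r ?nr_ge0// (le_trans (ler_norm L))//.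
  by rewrite lerDl.
have ZP y : Z (P y) by rewrite -PZ; exists y.
have PZ1 y : Z y -> P y = y by rewrite -PZ => -[u _ <-]; exact: PP.
have WP y : closed_span (P y) by exact: ZW.
have [||w [w0 wP]] := @dependent_sequence (X * nat) (fun=> setT)
  (fun _ w w' => [/\ Z w'.1, nr w'.1 = 1, forall i, (i < w.2)%N -> g i w'.1 = 0,
     nr (w'.1 - partial w'.2 w'.1) < 2^-1 & (w.2 < w'.2)%N]) (0, 0%N).
- by [].
- move=> _ [y0 m] _.
  have [i _ a u v _ _|y [Zy y0' gy]] :=
      infinite_dimensional_kers (f := g) (n := m) ZS _ Zinf.
    exact: (bg i).1.
  pose z := of_real s (nr y)^-1 *: y.
  have Zz : Z z by exact: linear_subspaceZ.
  have [N zN] := partial_cvg (ZW _ Zz) (e := 2^-1) ltac:(by []).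
  exists (z, (N + m).+1); split=> //; split=> //=.
  + by rewrite nrZ ab_of_real ger0_norm ?invr_ge0 ?nr_ge0// mulVf// gt_eqF// nr_gt0.
  + by move=> i im; rewrite functionalZ// gy// mulr0.
  + by apply: zN; rewrite (leq_trans (leq_addr m N)).
  + by rewrite ltnS leq_addl.
pose z k := (w k.+1).1; pose m k := (w k).2.
have zP k := (wP k).2.
have m_lt k : (m k < m k.+1)%N by have [] := zP k.
have m_le : {homo m : i j / (i <= j)%N}.
  by apply: homo_leq => // [i j k|i]; [exact: leq_trans|exact: ltnW].
have m_ge k : (k <= m k)%N.
  by elim: k => // k IH; exact: leq_ltn_trans IH (m_lt k).
(* kappa i is the index of the block containing i *)
have /choice[kappa kP] i : exists k, (m k <= i < m k.+1)%N.
  have : exists k, (i < m k.+1)%N by exists i; exact: m_ge i.+1.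
  move=> /ex_minnP[[|k] ik kmin]; first by exists 0%N; rewrite ik /m w0.
  exists k.+1; rewrite ik andbT leqNgt; apply/negP => /kmin.
  by rewrite ltnn.
have kappaE k i : (m k <= i < m k.+1)%N -> kappa i = k.
  move=> /andP[ki ik]; have /andP[k1 k2] := kP i.
  apply/eqP; rewrite eqn_leq; apply/andP; split; rewrite leqNgt; apply/negP => lt.
    by have := leq_trans ik (leq_trans (m_le _ _ lt) k1); rewrite ltnn.
  by have := leq_trans k2 (leq_trans (m_le _ _ lt) ki); rewrite ltnn.
have bk (a : nat -> K) : bounded_seq a -> bounded_seq (fun i => a (kappa i)).
  by move=> [M aM]; exists M => i.
have lim a y : exists l : X, bounded_seq a -> forall e : R, 0 < e ->
    exists N, forall n, (N <= n)%N -> nr (expansion (a \o kappa) n (P y) - l) < e.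
  have [ba|nba] := pselect (bounded_seq a); last by exists 0.
  by have [l lP] := expansion_cvg (bk _ ba) (WP y); exists l.
have /choice[S0 S0P] a : exists F : X -> X, forall y, bounded_seq a ->
    forall e : R, 0 < e -> exists N, forall n, (N <= n)%N ->
      nr (expansion (a \o kappa) n (P y) - F y) < e.
  by have [F FP] := choice (lim a); exists F.
have uniq a y l : bounded_seq a -> (forall e : R, 0 < e -> exists N, forall n, (N <= n)%N ->
    nr (expansion (a \o kappa) n (P y) - l) < e) -> S0 a y = l.
  move=> ba al; apply/eqP; rewrite -subr_eq0; apply/eqP/nr_le_eq0 => e e0.
  have e2 : 0 < e / 2 by rewrite divr_gt0.
  have [N NP] := S0P a y ba _ e2; have [N' NP'] := al _ e2.
  pose n := maxn N N'.
  rewrite (le_trans (nr_tri (expansion (a \o kappa) n (P y)) _ _))// nrC.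
  by rewrite [leRHS]splitr lerD// ltW// ?NP ?NP'// ?leq_maxl ?leq_maxr.
have S0b a y (M : R) : 0 < M -> (forall n, ab (a n) <= M) ->
    nr (S0 a y) <= 4 * C * M * p * nr y.
  move=> M0 aM; apply/ler_addgt0Pr => e e0.
  have [N NP] := S0P a y (ex_intro _ M aM) e e0.
  have := nrB (expansion (a \o kappa) N (P y)) (expansion (a \o kappa) N (P y) - S0 a y).
  rewrite opprB addrC subrK => /le_trans; apply.
  apply: lerD; last by rewrite ltW// NP.
  rewrite (le_trans (expansion_bound N (WP y) M0 (a := a \o kappa) (fun i => aM _)))//.
  by rewrite -[leRHS]mulrA ler_wpM2l// !mulr_ge0// ltW.
have Slin a b t : bounded_seq a -> bounded_seq b -> forall y,
    S0 (fun n => t * a n + b n) y = t *: S0 a y + S0 b y.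
  move=> [M aM] [M' bM'] y; apply: uniq.
    exists (ab t * M + M') => n; rewrite (le_trans (abD _ _))// abM lerD//.
    by rewrite ler_wpM2l ?ab_ge0.
  move=> e e0; have e2 : 0 < e / 2 by rewrite divr_gt0.
  have t1 : 0 < ab t + 1 by rewrite ltr_wpDl ?ab_ge0.
  have [N NP] := S0P a y (ex_intro _ M aM) _ (divr_gt0 e2 t1).
  have [N' NP'] := S0P b y (ex_intro _ M' bM') _ e2.
  exists (maxn N N') => n; rewrite geq_max => /andP[/NP an /NP' bn].
  have -> : expansion ((fun n => t * a n + b n) \o kappa) n (P y) =
      t *: expansion (a \o kappa) n (P y) + expansion (b \o kappa) n (P y).
    rewrite /expansion scaler_sumr -big_split; apply: eq_bigr => i _ /=.
    by rewrite mulrDl scalerDl scalerA mulrA.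
  rewrite opprD addrACA -scalerBr (le_lt_trans (nrD _ _))// nrZ.
  rewrite [ltRHS]splitr ltrD//.
  rewrite (@le_lt_trans _ _ ((ab t + 1) * nr (expansion (a \o kappa) n (P y) - S0 a y)))//.
    by rewrite ler_wpM2r ?nr_ge0// lerDl.
  by rewrite mulrC -ltr_pdivlMr.
have S0lin a : bounded_seq a -> linear (S0 a).
  move=> ba t y y'; apply: uniq => // e e0.
  have e2 : 0 < e / 2 by rewrite divr_gt0.
  have t1 : 0 < ab t + 1 by rewrite ltr_wpDl ?ab_ge0.
  have [N NP] := S0P a y ba _ (divr_gt0 e2 t1).
  have [N' NP'] := S0P a y' ba _ e2.
  exists (maxn N N') => n; rewrite geq_max => /andP[/NP an /NP' bn].
  have -> : expansion (a \o kappa) n (P (t *: y + y')) =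
      t *: expansion (a \o kappa) n (P y) + expansion (a \o kappa) n (P y').
    rewrite /expansion scaler_sumr -big_split; apply: eq_bigr => i _ /=.
    by rewrite linearP (bg i).1 mulrDr scalerDl scalerA mulrCA.
  rewrite opprD addrACA -scalerBr (le_lt_trans (nrD _ _))// nrZ.
  rewrite [ltRHS]splitr ltrD//.
  rewrite (@le_lt_trans _ _ ((ab t + 1) * nr (expansion (a \o kappa) n (P y) - S0 a y)))//.
    by rewrite ler_wpM2r ?nr_ge0// lerDl.
  by rewrite mulrC -ltr_pdivlMr.
have /choice[S SP] a : exists T : bounded_operator X X, bounded_seq a ->
    forall y, T y = S0 a y.
  have [ba|nba] := pselect (bounded_seq a); last by exists 0.
  have [M aM] := ba; pose M' := `|M| + 1; have M0 : 0 < M' by rewrite ltr_wpDl.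
  have [|T TE] := @bounded_operator_of R s X X (S0 a) (4 * C * M' * p) (S0lin a ba).
    move=> y; apply: S0b => // n.
    by rewrite (le_trans (aM n))// (le_trans (ler_norm M))// lerDl.
  by exists T.
exists S, (2 * C)^-1, (4 * C * p); split.
- move=> t a b ba bb; apply: bounded_operator_ext => y.
  rewrite bounded_operatorD bounded_operatorZ !SP//; first exact: Slin.
  have [M aM] := ba; have [M' bM'] := bb.
  exists (ab t * M + M') => n; rewrite (le_trans (abD _ _))// abM lerD//.
  by rewrite ler_wpM2l ?ab_ge0.
- by rewrite invr_gt0 mulr_gt0.
- move=> a M M0 aM; apply: nr_operator_le => [|y].
    by rewrite !mulr_ge0// ltW.
  rewrite SP; last by exists M.
  by rewrite (le_trans (S0b a y M M0 aM))// -[4 * C * M * p]mulrA [M * p]mulrC mulrA.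
move=> a k ba; rewrite ler_pdivrMl ?mulr_gt0//.
have [Zz z1 gz0 zm _] := zP k.
apply: (@le_trans _ _ (2 * C * nr (S0 a (z k)))); last first.
  rewrite ler_pM2l ?mulr_gt0// -SP// (le_trans (nr_operator _ _))//.
  by rewrite -/(z k) in z1; rewrite z1 mulr1.
apply/ler_addgt0Pr => e e0.
have [|N NP] := S0P a (z k) ba (e / (2 * C)); first by rewrite divr_gt0 ?mulr_gt0.
have {NP} := NP _ (leq_maxl N (m k.+1)); set n := maxn _ _ => nS.
have mn : (m k.+1 <= n)%N by rewrite leq_maxr.
rewrite PZ1// in nS.
(* the k-th block of the expansion at z k; z k starts at m k *)
have blockE : \sum_(i < n | kappa i == k) (a (kappa i) * g i (z k)) *: x i =
    a k *: partial (m k.+1) (z k).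
  rewrite /partial (big_ord_widen n (fun i => g i (z k) *: x i) mn) scaler_sumr.
  rewrite big_mkcond [RHS]big_mkcond; apply: eq_bigr => i _.
  have [im|mi] := ltnP i (m k.+1).
    have [ik|ki] := ltnP i (m k).
      by rewrite gz0// mulr0 !scale0r scaler0 if_same.
    by rewrite (kappaE k i) ?ki// eqxx scalerA.
  case: eqP => // ki; have := kP i; rewrite ki => /andP[_].
  by rewrite ltnNge mi.
have half : 2^-1 <= nr (partial (m k.+1) (z k)).
  have := nrD (z k - partial (m k.+1) (z k)) (partial (m k.+1) (z k)).
  rewrite subrK; move: zm z1; rewrite -/(z k) -/(m k.+1) => zm ->.
  lra.
have := Cx (fun i => a (kappa i) * g i (z k)) (fun i => kappa i == k) n.
rewrite blockE nrZ -/(expansion (a \o kappa) n (z k)) => le1.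
have le2 : nr (expansion (a \o kappa) n (z k)) <= nr (S0 a (z k)) + e / (2 * C).
  have := nrD (expansion (a \o kappa) n (z k) - S0 a (z k)) (S0 a (z k)).
  by rewrite subrK; move: nS; lra.
have le3 : ab (a k) * 2^-1 <= C * (nr (S0 a (z k)) + e / (2 * C)).
  rewrite (le_trans (ler_wpM2l (ab_ge0 _) half))// (le_trans le1)//.
  by rewrite ler_pM2l.
have : C * (nr (S0 a (z k)) + e / (2 * C)) = C * nr (S0 a (z k)) + e / 2.
  by field; rewrite gt_eqF.
rewrite -[2 * C * _]mulrA; lra.
Qed.

End unconditional_space.

(** * Spaces containing the bounded sequences *)

Section bounded_sequences.
Context {R : realType} {s : scalar_kind}.
Local Notation K := (scalars R s).
Implicit Types (a b : nat -> K).

Lemma ab_complete (u : nat -> K) :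
  (forall e : R, 0 < e -> exists N, forall m n, (N <= m)%N -> (N <= n)%N ->
     ab (u m - u n) < e) ->
  exists l, forall e : R, 0 < e -> exists N, forall n, (N <= n)%N ->
     ab (u n - l) < e.
Proof.
have realC (v : nat -> R) : (forall e : R, 0 < e -> exists N, forall m n,
    (N <= m)%N -> (N <= n)%N -> `|v m - v n| < e) ->
    exists l, forall e : R, 0 < e -> exists N, forall n, (N <= n)%N -> `|v n - l| < e.
  exact: (@nr_complete R RealScalars R^o v).
case: s u => u uc; first exact: realC.
have [|r rP] := realC (fun n => complex.Re (u n)).
  move=> e /uc[N uN]; exists N => m n Nm Nn; apply: le_lt_trans (uN m n Nm Nn).
  by case: (u m) (u n) => [a a'] [b b']; rewrite /ab /to_real /=; exact: normr_le_sqrtD.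
have [|t tP] := realC (fun n => complex.Im (u n)).
  move=> e /uc[N uN]; exists N => m n Nm Nn; apply: le_lt_trans (uN m n Nm Nn).
  case: (u m) (u n) => [a a'] [b b']; rewrite /ab /to_real /= (addrC (_ ^+ 2)); exact: normr_le_sqrtD.
exists (r +i* t)%C => e e0; have e2 : 0 < e / 2 by rewrite divr_gt0.
have [N NP] := rP _ e2; have [N' NP'] := tP _ e2.
exists (maxn N N') => n; rewrite geq_max => /andP[/NP nr /NP' nt].
rewrite (splitr e) (le_lt_trans _ (ltrD nr nt))//.
case: (u n) => a a' /=; rewrite /ab /to_real /=.
rewrite -(@ler_pXn2r _ 2)// ?nnegrE ?sqrtr_ge0 ?addr_ge0//.
rewrite sqr_sqrtr ?addr_ge0 ?sqr_ge0// [leRHS]sqrrD !real_normK ?num_real//.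
by rewrite addrAC lerDl mulrn_wge0// mulr_ge0.
Qed.

Definition vanishing a := forall e : R, 0 < e -> exists N, forall n, (N <= n)%N -> ab (a n) < e.

Definition finitely_supported a := exists N, forall n, (N <= n)%N -> a n = 0.

Lemma bounded_seq_comb t a b : bounded_seq a -> bounded_seq b ->
  bounded_seq (fun n => t * a n + b n).
Proof.
move=> [M aM] [M' bM']; exists (ab t * M + M') => n.
by rewrite (le_trans (abD _ _))// abM lerD// ler_wpM2l ?ab_ge0.
Qed.

Lemma vanishing_comb t a b : vanishing a -> vanishing b ->
  vanishing (fun n => t * a n + b n).
Proof.
move=> a0 b0 e e0; have e2 : 0 < e / 2 by rewrite divr_gt0.
have t1 : 0 < ab t + 1 by rewrite ltr_wpDl ?ab_ge0.
have [N aN] := a0 _ (divr_gt0 e2 t1); have [N' bN] := b0 _ e2.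
exists (maxn N N') => n; rewrite geq_max => /andP[/aN an /bN bn].
rewrite (le_lt_trans (abD _ _))// abM [ltRHS]splitr ltrD//.
rewrite (@le_lt_trans _ _ ((ab t + 1) * ab (a n)))//.
  by rewrite ler_wpM2r ?ab_ge0// lerDl.
by rewrite mulrC -ltr_pdivlMr.
Qed.

Lemma finitely_supported_vanishing a : finitely_supported a -> vanishing a.
Proof. by move=> [N aN] e e0; exists N => n /aN ->; rewrite ab0. Qed.

Lemma vanishing_bounded a : vanishing a -> bounded_seq a.
Proof.
move=> /(_ 1 ltr01)[N aN]; exists (1 + \sum_(i < N) ab (a i)) => n.
have S0 : 0 <= \sum_(i < N) ab (a i) by rewrite sumr_ge0// => i _; exact: ab_ge0.
have [nN|/aN/ltW] := ltnP n N; last by move=> /le_trans; apply; rewrite lerDl.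
rewrite (bigD1 (Ordinal nN)) //= addrCA lerDl addr_ge0// sumr_ge0// => i _.
exact: ab_ge0.
Qed.

Lemma vanishing_max a n0 : vanishing a -> a n0 != 0 ->
  exists2 p, a p != 0 & forall n, ab (a n) <= ab (a p).
Proof.
move=> a0 an0; have [N aN] := a0 _ (ab_gt0 an0).
have [p pP] : exists p, ab (a n0) <= ab (a p) /\ forall n, (n < N)%N -> ab (a n) <= ab (a p).
  elim: N {aN} => [|N [p [p0 pN]]]; first by exists n0.
  have [aNp|/ltW apN] := leP (ab (a N)) (ab (a p)).
    exists p; split=> // n; rewrite ltnS leq_eqVlt => /orP[/eqP ->//|]; exact: pN.
  exists N; split=> [|n]; first exact: le_trans apN.
  rewrite ltnS leq_eqVlt => /orP[/eqP ->//|/pN nN]; exact: le_trans apN.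
exists p => [|n].
  apply/eqP => ap0; have := pP.1; rewrite ap0 ab0 leNgt; apply/negP/negPn.
  exact: ab_gt0.
have [nN|/aN/ltW an] := ltnP n N; first exact: pP.2.
exact: le_trans an pP.1.
Qed.

(** The branches of the binary tree, coded in nat, are uncountably many
    infinite sets any two of which have finite intersection. *)
Definition branch (gamma : nat -> bool) : set nat :=
  [set m | exists n, m = pickle (mkseq gamma n)].

Lemma branch_infinite gamma N : exists2 m, (N <= m)%N & branch gamma m.
Proof.
apply: contrapT => nm.
have lt n : (pickle (mkseq gamma n) < N)%N.
  rewrite ltnNge; apply/negP => Nn; apply: nm.
  by exists (pickle (mkseq gamma n)) => //; exists n.
pose h (n : 'I_N.+1) : 'I_N := Ordinal (lt n).
have hinj : injective h.
  move=> i j /(congr1 val) /= /(pcan_inj pickleK) /(congr1 size).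
  by rewrite !size_mkseq => /val_inj.
by have := leq_card h hinj; rewrite !card_ord ltnn.
Qed.

Lemma branch_almost_disjoint gamma gamma' : gamma <> gamma' ->
  exists N, forall m, (N <= m)%N -> branch gamma m -> ~ branch gamma' m.
Proof.
move=> gg'; have [d gd] : exists d, gamma d <> gamma' d.
  by apply: contrapT => nd; apply: gg'; apply/funext => d; apply: contrapT => ?; apply: nd; exists d.
exists (\sum_(n < d.+1) pickle (mkseq gamma n)).+1 => m Nm [n mn] [n'].
rewrite mn => /(pcan_inj pickleK) nn'.
have := congr1 size nn'; rewrite !size_mkseq => nE; rewrite -nE in nn'.
have [dn|nd] := ltnP d n.
  have := congr1 (nth false ^~ d) nn'; rewrite !nth_mkseq//.
have nd1 : (n < d.+1)%N by rewrite ltnS.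
move: Nm; rewrite mn ltnNge => /negP; apply.
by rewrite (bigD1 (Ordinal nd1)) //= leq_addr.
Qed.

Definition indicator (A : set nat) : nat -> K := fun n => if `[< A n >] then 1 else 0.

Lemma indicator_bounded A : bounded_seq (indicator A).
Proof.
by exists 1 => n; rewrite /indicator; case: ifP => _; rewrite ?ab1// ab0.
Qed.

Definition linear_bounded_form (L : (nat -> K) -> K) (B : R) :=
  (forall t a b, bounded_seq a -> bounded_seq b ->
    L (fun n => t * a n + b n) = t * L a + L b) /\
  (forall a, (forall n, ab (a n) <= 1) -> ab (L a) <= B).

Lemma bounded_seq_sum n (c : 'I_n -> K) (f : 'I_n -> nat -> K) :
  (forall j, bounded_seq (f j)) -> bounded_seq (fun m => \sum_j c j * f j m).
Proof.
elim: n c f => [|n IH] c f fb.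
  by exists 0 => m; rewrite big_ord0 ab0.
under eq_fun do rewrite big_ord_recl.
by apply: bounded_seq_comb => //; apply: IH.
Qed.

Lemma linear_form_sum L B n (c : 'I_n -> K) (f : 'I_n -> nat -> K) :
  linear_bounded_form L B -> (forall j, bounded_seq (f j)) ->
  L (fun m => \sum_j c j * f j m) = \sum_j c j * L (f j).
Proof.
move=> [Llin _]; elim: n c f => [|n IH] c f fb.
  rewrite big_ord0; have b0 : bounded_seq (fun=> 0 : K) by exists 0 => m; rewrite ab0.
  rewrite -[RHS](addNr (L (fun=> 0))) -mulN1r -Llin//; congr L.
  by apply/funext => m; rewrite big_ord0 mulr0 addr0.
rewrite big_ord_recl -IH// -Llin//; last exact: bounded_seq_sum.
by congr L; apply/funext => m; rewrite big_ord_recl.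
Qed.

(** A bounded form that ignores finite modifications cannot be large on many
    almost disjoint sets, since a unimodular combination of their indicators
    agrees, up to a finite modification, with a sequence bounded by one. *)
Lemma few_large_branches L B n (gamma : nat -> nat -> bool) (eps : R) :
  linear_bounded_form L B ->
  (forall a, finitely_supported a -> L a = 0) -> injective gamma -> 0 < eps ->
  (forall j, (j < n)%N -> eps <= ab (L (indicator (branch (gamma j))))) ->
  eps * n%:R <= B.
Proof.
move=> LB Lfin ginj eps0 Lg; have [Llin Lb] := LB.
pose f (j : 'I_n) := indicator (branch (gamma j)).
(* c j turns the j-th value of L into its modulus *)
pose c (j : 'I_n) := of_real s (ab (L (f j))) / L (f j).
have Lf0 j : L (f j) != 0.
  apply/eqP => Lf; have := Lg j (ltn_ord j); rewrite -/(f j) Lf ab0.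
  by rewrite leNgt eps0.
have cab j : ab (c j) = 1.
  rewrite abM abV ab_of_real ger0_norm ?ab_ge0// divff//.
  by rewrite gt_eqF// ab_gt0.
have /choice[N NP] (ij : 'I_n * 'I_n) : exists N, ij.1 != ij.2 -> forall m, (N <= m)%N ->
    branch (gamma ij.1) m -> ~ branch (gamma ij.2) m.
  have [E|ij12] := eqVneq ij.1 ij.2; first by exists 0%N.
  have [|N NP] := @branch_almost_disjoint (gamma ij.1) (gamma ij.2).
    by move=> /ginj /val_inj /eqP; apply/negP.
  by exists N.
(* from N0 on, the n branches are pairwise disjoint *)
pose N0 := (\sum_ij N ij)%N.
pose a m := \sum_j c j * f j m.
pose a' m := if (m < N0)%N then 0 else a m.
have fb j : bounded_seq (f j) by exact: indicator_bounded.
have ba : bounded_seq a by exact: bounded_seq_sum.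
have a'1 m : ab (a' m) <= 1.
  rewrite /a'; case: ltnP => Nm; first by rewrite ab0.
  have [[j jm]|nj] := pselect (exists j : 'I_n, branch (gamma j) m); last first.
    rewrite /a big1 ?ab0// => j _; rewrite /f /indicator asboolF ?mulr0// => jm.
    by apply: nj; exists j.
  rewrite /a (bigD1 j) //= big1 => [|i ij].
    by rewrite addr0 /f /indicator asboolT// mulr1 cab.
  rewrite /f /indicator asboolF ?mulr0//; apply: (NP (j, i)) => //=.
    by rewrite eq_sym.
  by rewrite (leq_trans _ Nm)// /N0 (bigD1 (j, i)) //= leq_addr.
have ba' : bounded_seq a' by exists 1.
have La : L a = L a'.
  have -> : a = fun m => 1 * (a m - a' m) + a' m.
    by apply/funext => m; rewrite mul1r subrK.
  have fd : finitely_supported (fun m => a m - a' m).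
    by exists N0 => m Nm; rewrite /a' ltnNge Nm subrr.
  have fdb := vanishing_bounded (finitely_supported_vanishing fd).
  by rewrite (Llin 1 _ a' fdb ba') Lfin// mulr0 add0r.
have : ab (L a) <= B by rewrite La; exact: Lb.
apply: le_trans; rewrite /a (linear_form_sum _ LB)//.
have -> : \sum_j c j * L (f j) = of_real s (\sum_j ab (L (f j))).
  rewrite (big_morph (of_real s) (id1 := 0) (op1 := +%R) (@of_realD R s) of_real0).
  by apply: eq_bigr => j _; rewrite /c divfK.
rewrite ab_of_real ger0_norm; last by rewrite sumr_ge0// => j _; exact: ab_ge0.
apply: (@le_trans _ _ (\sum_(j < n) eps)).
  by rewrite sumr_const card_ord mulr_natr.
by apply: ler_sum => j _; exact: Lg.
Qed.

(** Cantor's diagonal argument. *)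
Lemma bool_sequences_not_enumerable (e : nat -> nat -> bool) :
  exists gamma, forall n, e n <> gamma.
Proof.
exists (fun n => ~~ e n n) => n /(congr1 (fun h => h n)).
by case: (e n n).
Qed.

(** Each coordinate is larger than 1/n on finitely many branches only, and
    there are uncountably many branches. *)
Lemma annihilated_branch (L : nat -> (nat -> K) -> K) (B : R) :
  (forall i, linear_bounded_form (L i) B) ->
  (forall i a, finitely_supported a -> L i a = 0) ->
  exists gamma, forall i, L i (indicator (branch gamma)) = 0.
Proof.
move=> LB Lfin; apply: contrapT => ngamma.
pose F (q : nat * nat) := [set gamma | q.2.+1%:R^-1 <= ab (L q.1 (indicator (branch gamma)))].
have Ffin q : finite_set (F q).
  apply: contrapT => /infiniteP/pcard_leP[h].
  have [n nB] : exists n : nat, B < q.2.+1%:R^-1 * n%:R.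
    exists (Num.truncn (B * q.2.+1%:R)).+1; rewrite ltr_pdivlMl ?ltr0n//.
    rewrite mulrC; exact: truncnS_gt.
  have hinj : injective h by move=> i j; apply: inj; rewrite in_setT.
  have := @few_large_branches (L q.1) B n h _ (LB _) (Lfin _) hinj.
  move=> /(_ q.2.+1%:R^-1); rewrite invr_gt0 ltr0n leNgt nB => H.
  suff : false by []; apply: H => // j _.
  by have := @funS _ _ _ _ h j I; rewrite /F.
have /choice[l lP] q : exists l : seq (nat -> bool), forall gamma, F q gamma -> gamma \in l.
  have /finite_seqP[l Fl] := Ffin q; exists l => gamma.
  by rewrite Fl.
pose e n : nat -> bool := if @unpickle (nat * nat * nat)%type n is Some (q, k)
  then nth (fun=> false) (l q) k else fun=> false.
have [gamma ge] := bool_sequences_not_enumerable e.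
apply: ngamma; exists gamma => i; apply/eqP; apply: contrapT => /negP Li.
have Li0 := ab_gt0 Li.
have [n nL] : exists n : nat, n.+1%:R^-1 <= ab (L i (indicator (branch gamma))).
  exists (Num.truncn (ab (L i (indicator (branch gamma))))^-1).
  rewrite invf_ple ?posrE ?ltr0n// ltW// truncnS_gt//.
have gl : gamma \in l (i, n) by exact: lP.
apply: (ge (pickle ((i, n), index gamma (l (i, n))))).
by rewrite /e pickleK nth_index.
Qed.

End bounded_sequences.

Section linf_not_subprojective.
Context {R : realType} {s : scalar_kind}.
Local Notation K := (scalars R s).
Context {E : completeNormedModType K} (S : (nat -> K) -> E) (c C : R).
Context (ES : linf_embedding S c C).
Implicit Types (a b : nat -> K).

Let c0 : 0 < c. Proof. exact: linf_embedding_gt0 ES. Qed.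

Let SB a b : bounded_seq a -> bounded_seq b -> S (fun n => a n - b n) = S a - S b.
Proof.
move=> ba bb; have := linf_embedding_linear ES (-1) bb ba.
rewrite scaleN1r addrC => <-; congr S; apply/funext => n.
by rewrite mulN1r addrC.
Qed.

Let bounded_seqB a b : bounded_seq a -> bounded_seq b -> bounded_seq (fun n => a n - b n).
Proof.
move=> ba bb; have := bounded_seq_comb (-1) bb ba.
by congr bounded_seq; apply/funext => n; rewrite mulN1r addrC.
Qed.

Let S_inj a b : bounded_seq a -> bounded_seq b -> S a = S b -> a = b.
Proof.
move=> ba bb Sab; apply/funext => n; apply/eqP; rewrite -subr_eq0; apply/eqP/ab_eq0.
have := linf_embedding_lower ES n (bounded_seqB ba bb); rewrite SB// Sab subrr nr0.
rewrite pmulr_rle0// => ab0; apply/eqP; rewrite eq_le ab0; exact: ab_ge0.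
Qed.

Let bounded0 : bounded_seq (fun=> 0 : K).
Proof. by exists 0 => n; rewrite ab0. Qed.

Let S0 : S (fun=> 0) = 0.
Proof.
rewrite -[RHS](subrr (S (fun=> 0))) -SB//; congr S.
by apply/funext => n; rewrite subrr.
Qed.

Let Y : set E := [set S a | a in vanishing].

Let Y_linear : linear_subspace Y.
Proof.
split; first by exists (fun=> 0) => // e e0; exists 0%N => n _; rewrite ab0.
move=> t _ _ [a a0 <-] [b b0 <-]; exists (fun n => t * a n + b n).
  exact: vanishing_comb.
by rewrite (linf_embedding_linear ES)//; exact: vanishing_bounded.
Qed.

Let delta (k : nat) : nat -> K := fun n => (n == k)%:R.

Let delta_vanishing k : vanishing (delta k).
Proof.
apply: finitely_supported_vanishing; exists k.+1 => n kn.
by rewrite /delta gtn_eqF.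
Qed.

Let Y_infinite : infinite_dimensional Y.
Proof.
apply: (@infinite_dimensional_free _ _ Y (fun k => S (delta k))).
  by move=> k; exists (delta k).
move=> n d.
have sumE : \sum_(k < n) d k *: S (delta k) = S (fun i => if (i < n)%N then d i else 0) /\
    bounded_seq (fun i => if (i < n)%N then d i else 0).
  elim: n => [|n [IH IHb]].
    by rewrite big_ord0 S0.
  have -> : (fun i => if (i < n.+1)%N then d i else 0) =
      (fun i => d n * delta n i + (if (i < n)%N then d i else 0)).
    apply/funext => i; rewrite ltnS leq_eqVlt /delta.
    by have [->|] := eqVneq i n; rewrite ?ltnn ?mulr1 ?addr0// mulr0 add0r.
  have bd : bounded_seq (delta n) by exact/vanishing_bounded/delta_vanishing.
  split; last exact: bounded_seq_comb.
  by rewrite big_ord_recr /= IH (linf_embedding_linear ES)// addrC.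
have [-> db] := sumE; rewrite -S0 => /(S_inj db bounded0) d0 k kn.
by have := congr1 (fun h => h k) d0; rewrite kn.
Qed.

Let Y_closed : closed Y.
Proof.
apply/closedP => y yY.
have /choice[u uP] (j : nat) : exists a, vanishing a /\ nr (y - S a) < j.+1%:R^-1.
  by have [|_ [a a0 <-] ya] := yY j.+1%:R^-1; [rewrite invr_gt0|exists a].
have ub j : bounded_seq (u j) by apply: vanishing_bounded; exact: (uP j).1.
have small (e : R) : 0 < e -> exists N : nat, forall j, (N <= j)%N -> j.+1%:R^-1 < e.
  move=> e0; exists (Num.truncn e^-1) => j Nj; rewrite invf_plt ?posrE//.
  by rewrite (lt_le_trans (truncnS_gt _))// ler_nat ltnS.
have diff j l n : c * ab (u j n - u l n) <= j.+1%:R^-1 + l.+1%:R^-1.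
  rewrite (le_trans (linf_embedding_lower ES n (bounded_seqB (ub j) (ub l))))//.
  rewrite SB// (le_trans (nr_tri y _ _))// nrC lerD// ltW//; first exact: (uP j).2.
  exact: (uP l).2.
have /choice[b bP] n : exists l, forall e : R, 0 < e -> exists N, forall j, (N <= j)%N ->
    ab (u j n - l) < e.
  apply: ab_complete => e e0; have ce : 0 < c * e / 2 by rewrite divr_gt0// mulr_gt0.
  have [N NP] := small _ ce; exists N => j l Nj Nl.
  rewrite -(ltr_pM2l c0) (le_lt_trans (diff j l n))//.
  by rewrite [ltRHS](splitr (c * e)) ltrD// NP.
have unif j n : c * ab (u j n - b n) <= 2 * j.+1%:R^-1.
  apply/ler_addgt0Pr => e e0.
  have [N NP] := bP n (e / c) (divr_gt0 e0 c0).
  pose l := maxn N j.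
  have h1 : c * ab (u l n - b n) <= e.
    by rewrite mulrC -ler_pdivlMr// ltW// NP// leq_maxl.
  have h2 : (l.+1%:R : R)^-1 <= j.+1%:R^-1.
    by rewrite lef_pV2 ?posrE// ler_nat ltnS leq_maxr.
  have h3 : ab (u j n - b n) <= ab (u j n - u l n) + ab (u l n - b n).
    by rewrite (le_trans _ (abD _ _))// subrKA.
  have := ler_wpM2l (ltW c0) h3; rewrite mulrDr; have := diff j l n.
  move: h1 h2; move: (j.+1%:R^-1 : R) (l.+1%:R^-1 : R) => dj dl.
  lra.
have b0 : vanishing b.
  move=> e e0; have ce : 0 < c * e / 2 / 2 by rewrite !divr_gt0// mulr_gt0.
  have [j /(_ j (leqnn j)) jP] := small _ ce.
  have e2 : 0 < e / 2 by rewrite divr_gt0.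
  have [N NP] := (uP j).1 _ e2; exists N => n Nn.
  have := NP n Nn; have := unif j n.
  have h : ab (b n) <= ab (u j n) + ab (u j n - b n).
    by have := abD (u j n) (- (u j n - b n)); rewrite abN opprB addrC subrK.
  move: h; rewrite -(ler_pM2l c0) mulrDr => h u1 u2.
  rewrite -(ltr_pM2l c0) mulrA in u2; rewrite -(ltr_pM2l c0).
  by move: jP u1; move: (j.+1%:R^-1 : R) => dj; lra.
have bb := vanishing_bounded b0.
exists b => //; apply/esym/eqP; rewrite -subr_eq0; apply/eqP/nr_le_eq0 => e e0.
have C1 : 0 < 1 + `|C| * (2 / c) by rewrite ltr_wpDr// mulr_ge0// divr_ge0// ltW.
have [j /(_ j (leqnn j)) jP] := small _ (divr_gt0 e0 C1).
have h1 : nr (S (u j) - S b) <= `|C| * (2 / c) * j.+1%:R^-1.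
  have j0 : 0 < 2 * (j.+1%:R : R)^-1 / c by rewrite divr_gt0// mulr_gt0// invr_gt0.
  have := linf_embedding_upper ES (a := fun n => u j n - b n) j0.
  rewrite SB// => h; rewrite (le_trans (h _))//.
    by move=> n; rewrite ler_pdivlMr// mulrC.
  rewrite -(mulrA `|C|) (mulrAC 2) ler_wpM2r ?ler_norm//; rewrite mulrAC; exact: ltW.
rewrite (le_trans (nr_tri (S (u j)) _ _))//.
have := (uP j).2; move: jP h1; rewrite ltr_pdivlMr// mulrDr mulr1 [_ * (`|C| * _)]mulrC.
move: (`|C| * (2 / c) / j.+1%:R) (j.+1%:R^-1 : R) => r dj; lra.
Qed.

(** In the coordinates of the embedding, a projection onto a subspace of the
    image of c_0 is an operator T with values in c_0. If z is a gliding hump in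
    its range and V a the sum of the a k z k, then T V - V kills the finitely
    supported sequences, hence the indicator of some infinite branch; for this
    indicator a, V a = T (V a) tends to zero, against its values at the peaks
    of the humps. *)
Theorem linf_not_subprojective : ~ subprojective E.
Proof.
move=> subE; have [Z ZY [_ ZS Zinf [P [Pc PP PZ]]]] := subE Y Y_closed Y_linear Y_infinite.
have [N PN] := (continuous_nrP P).1 Pc.
pose p := `|N| + 1; have p0 : 0 < p by rewrite ltr_wpDl.
have Pp y : nr (P y) <= p * nr y.
  rewrite (le_trans (PN y))// ler_wpM2r ?nr_ge0// (le_trans (ler_norm N))//.
  by rewrite lerDl.
have ZP y : Z (P y) by rewrite -PZ; exists y.
have PZ1 y : Z y -> P y = y by rewrite -PZ => -[u _ <-]; exact: PP.
have /choice[coord coordP] y : exists a, Y y -> vanishing a /\ S a = y.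
  have [[a a0 <-]|nY] := pselect (Y y); first by exists a.
  by exists (fun=> 0).
pose T a := coord (P (S a)).
have T0 a : vanishing (T a) by have [] := coordP _ (ZY _ (ZP (S a))).
have Tb a : bounded_seq (T a) by exact: vanishing_bounded.
have ST a : S (T a) = P (S a) by have [] := coordP _ (ZY _ (ZP (S a))).
have Tlin t a b : bounded_seq a -> bounded_seq b ->
    T (fun n => t * a n + b n) = (fun n => t * T a n + T b n).
  move=> ba bb; apply: S_inj => //; first exact: bounded_seq_comb.
  by rewrite ST !(linf_embedding_linear ES)// !ST linearP.
have Tbound a M n : 0 < M -> (forall n, ab (a n) <= M) -> ab (T a n) <= p * C * M / c.
  move=> M0 aM; rewrite ler_pdivlMr// mulrC.
  rewrite (le_trans (linf_embedding_lower ES n (Tb a)))// ST (le_trans (Pp _))//.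
  by rewrite -mulrA ler_pM2l//; exact: (linf_embedding_upper ES).
(* a hump w.1 with peak w.2, starting at m and smaller than eta after m' *)
pose hump (m : nat) (w : (nat -> K) * nat) (m' : nat) (eta : R) :=
  [/\ T w.1 = w.1, bounded_seq w.1 & [/\ forall i, (i < m)%N -> w.1 i = 0,
    forall i, ab (w.1 i) <= 1, ab (w.1 w.2) = 1, (m <= w.2 < m')%N &
    forall i, (m' <= i)%N -> ab (w.1 i) <= eta]].
(* the eta sum up to at most 1 / 2, so the peaks of a sum of humps are at
   least 1 / 2 *)
have [||w [w0 wP]] := @dependent_sequence (((nat -> K) * nat) * nat) (fun=> setT)
  (fun k w w' => hump w.2 w'.1 w'.2 (2^-1 * 2^-1 ^+ k.+1)) ((fun=> 0, 0%N), 0%N).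
- by [].
- move=> k [w m] _ /=.
  have [i _ t y y' Zy Zy'|y [Zy y0 ym]] :=
      infinite_dimensional_kers (f := fun i y => coord y i) (n := m) ZS _ Zinf.
    have [y1 Sy] := coordP _ (ZY _ Zy); have [y1' Sy'] := coordP _ (ZY _ Zy').
    have [y2 Sy2] := coordP _ (ZY _ (ZS.2 t _ _ Zy Zy')).
    suff -> : coord (t *: y + y') = (fun i => t * coord y i + coord y' i) by [].
    apply: S_inj; [exact: vanishing_bounded| |].
      by apply: bounded_seq_comb; exact: vanishing_bounded.
    by rewrite (linf_embedding_linear ES) ?Sy ?Sy'//; exact: vanishing_bounded.
  have [a0 Sa] := coordP _ (ZY _ Zy); set a := coord y in a0 Sa.
  have am i : (i < m)%N -> a i = 0 by exact: ym.
  have ba := vanishing_bounded a0.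
  have [i ai] : exists i, a i != 0.
    apply: contrapT => na; move/eqP: y0; apply; rewrite -Sa -S0; congr S.
    by apply/funext => i; apply/eqP; apply: contrapT => /negP ai; apply: na; exists i.
  have [q aq qmax] := vanishing_max a0 ai.
  pose z n := (a q)^-1 * a n + 0.
  have z0 : vanishing z by apply: vanishing_comb => // e e0; exists 0%N => n _; rewrite ab0.
  have mq : (m <= q)%N by rewrite leqNgt; apply/negP => /am aq0; rewrite aq0 eqxx in aq.
  have aqi := ab_gt0 aq.
  have [M MP] : exists M, forall i, (M <= i)%N -> ab (z i) < 2^-1 * 2^-1 ^+ k.+1.
    by apply: z0; rewrite mulr_gt0// exprn_gt0.
  exists ((z, q), (M + q).+1); split=> //; split=> /=.
  + have Ta : T a = a by apply: S_inj => //; rewrite ST Sa PZ1.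
    have T00 : T (fun=> 0) = fun=> 0 by apply: S_inj => //; rewrite ST S0 linear0.
    by rewrite Tlin// Ta T00.
  + exact: vanishing_bounded.
  + split=> [i' im|i'|||i' Mi].
    * by rewrite /z (am _ im) mulr0 addr0.
    * by rewrite /z addr0 abM abV mulrC ler_pdivrMr// mul1r.
    * by rewrite /z addr0 mulVf// ab1.
    * by rewrite mq ltnS leq_addl.
    * by apply/ltW/MP; rewrite (leq_trans _ Mi)// ltnW// ltnS leq_addr.
pose z k := (w k.+1).1.1; pose q k := (w k.+1).1.2; pose m k := (w k).2.
have [Tz bz hP] : [/\ forall k, T (z k) = z k, forall k, bounded_seq (z k) &
    forall k, [/\ forall i, (i < m k)%N -> z k i = 0,
      forall i, ab (z k i) <= 1, ab (z k (q k)) = 1, (m k <= q k < m k.+1)%N &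
      forall i, (m k.+1 <= i)%N -> ab (z k i) <= 2^-1 * 2^-1 ^+ k.+1]].
  by split=> k; have [_ H] := wP k; move: H; rewrite /hump => -[].
have zm k i : (i < m k)%N -> z k i = 0 by have [+ _ _ _ _] := hP k; apply.
have z1 k i : ab (z k i) <= 1 by have [_ + _ _ _] := hP k; apply.
have zq k : ab (z k (q k)) = 1 by have [] := hP k.
have mq k : (m k <= q k < m k.+1)%N by have [] := hP k.
have zeta k i : (m k.+1 <= i)%N -> ab (z k i) <= 2^-1 * 2^-1 ^+ k.+1.
  by have [_ _ _ _ +] := hP k; apply.
have m_lt k : (m k < m k.+1)%N by have /andP[/leq_ltn_trans] := mq k; apply.
have m_le : {homo m : i j / (i <= j)%N}.
  by apply: homo_leq => // [i j k|i]; [exact: leq_trans|exact: ltnW].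
have m_ge k : (k <= m k)%N by elim: k => // k IH; exact: leq_ltn_trans IH (m_lt k).
pose V a i := \sum_(k < i.+1) a k * z k i.
have VE a n i : (i < m n)%N -> V a i = \sum_(k < n) a k * z k i.
  move=> im; have ext n1 n2 : (n1 <= n2)%N -> (i < m n1)%N ->
      \sum_(k < n1) a k * z k i = \sum_(k < n2) a k * z k i.
    elim: n2 => [|n2 IH]; first by rewrite leqn0 => /eqP ->.
    rewrite leq_eqVlt => /orP[/eqP -> //|]; rewrite ltnS => n12 im1.
    rewrite big_ord_recr /= -IH// zm ?mulr0 ?addr0//.
    exact: leq_trans im1 (m_le _ _ n12).
  have [ni|/ltnW ni] := leqP n i.+1; first by rewrite (ext n i.+1).
  by rewrite -(ext i.+1 n)// (leq_trans _ (m_ge _)).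
(* at most one of the z k has its hump around i; the others are below eta *)
have Vbound a M i : (forall n, ab (a n) <= M) -> 0 <= M -> ab (V a i) <= M * 2.
  move=> aM M0; rewrite (le_trans (ab_sum _ _ _))//.
  apply: (@le_trans _ _ (\sum_(k < i.+1) M * ab (z k i))).
    by apply: ler_sum => k _; rewrite abM ler_wpM2r// ab_ge0.
  rewrite -mulr_sumr ler_wpM2l//.
  suff : forall n, \sum_(k < n) ab (z k i) <=
      2^-1 * (\sum_(k < n) 2^-1 ^+ k.+1) + (if (i < m n)%N then 1 else 0).
    move=> /(_ i.+1); rewrite (m_ge i.+1) => /le_trans; apply.
    have := geometric_sum_le1 R i.+1; lra.
  elim=> [|n IH]; first by rewrite !big_ord0 mulr0 add0r; case: ifP.
  rewrite !big_ord_recr /= mulrDr.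
  have e0 : 0 <= 2^-1 * 2^-1 ^+ n.+1 :> R by rewrite mulr_ge0// exprn_ge0.
  move: IH; set A := \sum_(k < n) _; set B := 2^-1 * \sum_(k < n) _ => IH.
  have [imn|min] := ltnP i (m n).
    rewrite imn in IH; rewrite (zm _ _ imn) ab0 (ltn_trans imn (m_lt n)).
    move: e0 IH; lra.
  rewrite ltnNge min /= in IH.
  have [im|mi] := ltnP i (m n.+1); first by have := z1 n i; move: e0 IH; lra.
  by have := zeta n i mi; move: IH; lra.
have Vb a : bounded_seq a -> bounded_seq (V a).
  move=> [M aM]; exists (M * 2) => i; apply: Vbound => //.
  exact: le_trans (ab_ge0 _) (aM 0%N).
have Vlin t a b : V (fun n => t * a n + b n) = (fun n => t * V a n + V b n).
  apply/funext => i; rewrite /V mulr_sumr -big_split; apply: eq_bigr => k _ /=.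
  by rewrite mulrDl mulrA.
have Vdelta k : V (delta k) = z k.
  apply/funext => i; rewrite /V; have [ki|ik] := ltnP k i.+1.
    rewrite (bigD1 (Ordinal ki)) //= big1 => [|l lk].
      by rewrite /delta eqxx mul1r addr0.
    by move: lk; rewrite -val_eqE /= /delta => /negPf ->; rewrite mul0r.
  rewrite big1 => [|l _]; first by rewrite zm// (leq_trans ik)// m_ge.
  by rewrite /delta ltn_eqF ?mul0r// (leq_trans _ ik).
pose L i a := T (V a) i - V a i.
have Llin i t a b : bounded_seq a -> bounded_seq b ->
    L i (fun n => t * a n + b n) = t * L i a + L i b.
  by move=> ba bb; rewrite /L Vlin Tlin; [ring|exact: Vb|exact: Vb].
have Lform i : linear_bounded_form (L i) (p * C * 2 / c + 2).
  split; first exact: Llin.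
  move=> a a1; have V2 n : ab (V a n) <= 2 by rewrite -[leRHS]mul1r Vbound.
  rewrite (le_trans (abD _ _))// abN lerD//; exact: Tbound.
have Lfin i a : finitely_supported a -> L i a = 0.
  move=> [n]; elim: n a => [|n IH] a an.
    have -> : a = fun=> 0 by apply/funext => k; exact: an.
    rewrite -[RHS](addNr (L i (fun=> 0))) -mulN1r -Llin//; congr (L i).
    by apply/funext => k; rewrite mulr0 addr0.
  pose a' k := if k == n then 0 else a k.
  have -> : a = fun k => a n * delta n k + a' k.
    apply/funext => k; rewrite /delta /a'.
    by have [->|] := eqVneq k n; rewrite ?mulr1 ?addr0// mulr0 add0r.
  have a'n k : (n <= k)%N -> a' k = 0.
    rewrite /a'; case: eqVneq => // kn nk; apply: an.
    by rewrite ltn_neqAle eq_sym kn.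
  rewrite Llin; first by rewrite (IH a')// addr0 /L Vdelta Tz subrr mulr0.
  - exact/vanishing_bounded/delta_vanishing.
  - by apply/vanishing_bounded/finitely_supported_vanishing; exists n.
have [gamma Lgamma] := annihilated_branch Lform Lfin.
set a := indicator (branch gamma) in Lgamma.
have TV : T (V a) = V a by apply/funext => i; apply/eqP; rewrite -subr_eq0; apply/eqP; exact: Lgamma.
have V0 : vanishing (V a) by rewrite -TV.
have [|n nP] := V0 2^-1; first by rewrite invr_gt0.
have [k nk ak] := branch_infinite gamma n.
have /andP[mk km] := mq k.
have := nP (q k) (leq_trans nk (leq_trans (m_ge k) mk)).
rewrite (VE _ k.+1)// big_ord_recr /= {2}/a /indicator asboolT// mul1r.
apply/negP; rewrite -leNgt.
set u := \sum_(l < k) _.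
have : ab u <= 2^-1.
  rewrite (le_trans (ab_sum _ _ _))//.
  apply: (@le_trans _ _ (\sum_(l < k) 2^-1 * 2^-1 ^+ l.+1)).
    apply: ler_sum => l _; rewrite abM.
    have al : ab (a l) <= 1 by rewrite /a /indicator; case: ifP => _; rewrite ?ab1// ab0.
    rewrite (le_trans (ler_wpM2r (ab_ge0 _) al))// mul1r zeta//.
    exact: leq_trans (m_le _ _ (ltn_ord l)) mk.
  by rewrite -mulr_sumr ler_piMr// geometric_sum_le1.
have := abD (u + z k (q k)) (- u); rewrite addrAC subrr add0r zq abN; lra.
Qed.

End linf_not_subprojective.

Theorem theorem3p9 (R : realType) (s : scalar_kind)
    (X : completeNormedModType (scalars R s)) :
  infinite_dimensional [set: X]%classic ->
  ~ subprojective (bounded_operator X X).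
Proof.
move=> Xinf subB; have subX := subprojective_operators Xinf subB.
have [x [g [C [bg gx C1 Cx]]]] := subprojective_unconditional_sequence Xinf subX.
have [S [c [c' SE]]] := linf_operators bg gx C1 Cx subX.
exact: linf_not_subprojective SE subB.
Qed.
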